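(* Consider the switched descriptor system $E_{\sigma(t)}\dot x=A_{\sigma(t)}x$, $\sigma(t)\in\{1,2\}$, with $E_i,A_i\in\mathbb{R}^{n\times n}$, $A_1,A_2$ nonsingular. For $i=1,2$ let $(X_i,Y_i)$ be a full rank decomposition of $E_i$ with $X_i,Y_i\in\mathbb{R}^{n\times r}$ (so $\mathrm{rank}\,E_1=\mathrm{rank}\,E_2=r$), and set $\tilde E_i=Y_i^TA_i^{-1}X_i\in\mathbb{R}^{r\times r}$. Assume that for every solution, $Y_j^Tx(t_*^+)=Y_i^Tx(t_*^-)$ whenever $\sigma$ switches from $i$ to $j$ at $t_*$. Suppose: (a) $(E_1,A_1)$ and $(E_2,A_2)$ are stable; (b) $(E_1,A_1)$ has index one and $(E_2,A_2)$ has index two; (c) there exist vectors $g,h\in\mathbb{R}^r$ with $\tilde E_2=\tilde E_1-gh^T$, where $(\tilde E_1,g)$ is controllable and $(\tilde E_1,h)$ is observable (i.e. $(h^T,\tilde E_1)$ is an observable pair); (d) $\tilde E_1\tilde E_2$ has no negative real eigenvalues and exactly one zero eigenvalue. Then the switched system is GUES.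
   Context: For $E,A\in\mathbb{R}^{n\times n}$ with $A$ nonsingular, $(E,A)$ denotes the descriptor system $E\dot x=Ax$. It is stable if every root $s$ of $\det(sE-A)=0$ has negative real part. Its index is the smallest integer $k^*\ge0$ with $\mathrm{Im}((A^{-1}E)^{k^*+1})=\mathrm{Im}((A^{-1}E)^{k^*})$, and its consistency space is $\mathcal{C}(E,A)=\mathrm{Im}((A^{-1}E)^{k^*})$. A full rank decomposition of $E$ is a pair $(X,Y)$ of matrices with full column rank such that $E=XY^T$. Switched descriptor system: the switching signal $\sigma$ is piecewise constant with finitely many discontinuities in every bounded interval; a solution $x(\cdot)$ is differentiable and satisfies $E_{\sigma(t)}\dot x(t)=A_{\sigma(t)}x(t)$ at every $t$ where $\sigma$ is continuous, with one-sided limits $x(t_*^\pm)$ at discontinuities of $\sigma$ (the equation is not required there). The system is GUES if there exist $\beta,\alpha>0$ such that every solution satisfies $\|x(t)\|\le\beta e^{-\alpha(t-t_0)}\|x(t_0)\|$ for all $t\ge t_0$. *)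

(* Defs.v *)
From HB Require Import structures.
From Stdlib Require Import Reals ClassicalEpsilon FunctionalExtensionality.
From mathcomp Require Import all_boot all_order all_algebra.
Set Implicit Arguments. Unset Strict Implicit. Unset Printing Implicit Defensive.

Definition R_eqb (x y : R) : bool := if Req_EM_T x y then true else false.
Lemma R_eqP : Equality.axiom R_eqb.
Proof. by move=> x y; rewrite /R_eqb; case: Req_EM_T => h; constructor. Qed.
HB.instance Definition _ := hasDecEq.Build R R_eqP.

Definition R_find (P : pred R) (_ : nat) : option R :=
  match excluded_middle_informative (exists x, P x) with
  | left h => Some (proj1_sig (constructive_indefinite_description _ h))
  | right _ => None
  end.
Lemma R_find_correct P n x : R_find P n = Some x -> P x.
Proof.
rewrite /R_find; case: excluded_middle_informative => // h [<-].
by case: constructive_indefinite_description.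
Qed.
Lemma R_find_complete (P : pred R) : (exists x, P x) -> exists n, R_find P n.
Proof. by move=> h; exists 0%N; rewrite /R_find; case: excluded_middle_informative. Qed.
Lemma R_find_ext (P Q : pred R) : P =1 Q -> R_find P =1 R_find Q.
Proof. by move=> /functional_extensionality ->. Qed.
HB.instance Definition _ := hasChoice.Build R R_find_correct R_find_complete R_find_ext.

Lemma R_addA : associative Rplus. Proof. by move=> *; rewrite Rplus_assoc. Qed.
Lemma R_addC : commutative Rplus. Proof. exact: Rplus_comm. Qed.
Lemma R_add0 : left_id R0 Rplus. Proof. exact: Rplus_0_l. Qed.
Lemma R_addN : left_inverse R0 Ropp Rplus. Proof. exact: Rplus_opp_l. Qed.
HB.instance Definition _ := GRing.isZmodule.Build R R_addA R_addC R_add0 R_addN.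

Lemma R_mulA : associative Rmult. Proof. by move=> *; rewrite Rmult_assoc. Qed.
Lemma R_mulC : commutative Rmult. Proof. exact: Rmult_comm. Qed.
Lemma R_mul1 : left_id R1 Rmult. Proof. exact: Rmult_1_l. Qed.
Lemma R_mulD : left_distributive Rmult (@GRing.add R). Proof. exact: Rmult_plus_distr_r. Qed.
Lemma R_one_neq0 : R1 != R0.
Proof. by apply/eqP; exact: R1_neq_R0. Qed.
HB.instance Definition _ :=
  GRing.Zmodule_isComNzRing.Build R R_mulA R_mulC R_mul1 R_mulD R_one_neq0.

Definition R_inv (x : R) : R := if x == 0%R then 0%R else Rinv x.
Lemma R_mulV (x : R) : x != 0%R -> (R_inv x * x)%R = 1%R.
Proof. by move=> h; rewrite /R_inv (negbTE h); apply: Rinv_l; apply/eqP. Qed.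
Lemma R_inv0 : R_inv 0%R = 0%R.
Proof. by rewrite /R_inv eqxx. Qed.
HB.instance Definition _ := GRing.ComNzRing_isField.Build R R_mulV R_inv0.

Local Open Scope ring_scope.

Definition mxpow (n : nat) (M : 'M[R]_n) (k : nat) : 'M[R]_n := iter k (mulmx M) 1%:M.

Definition colspace_eq (m n p : nat) (M : 'M[R]_(m, n)) (N : 'M[R]_(m, p)) : bool :=
  (M^T == N^T)%MS.

Definition desc_index (n : nat) (E A : 'M[R]_n) (k : nat) : Prop :=
  let P := invmx A *m E in
  colspace_eq (mxpow P k.+1) (mxpow P k) /\
  (forall j : nat, (j < k)%N -> ~~ colspace_eq (mxpow P j.+1) (mxpow P j)).

(* complex numbers as pairs (Re, Im); complex evaluation of a real polynomial *)
Definition Cmul (z w : R * R) : R * R :=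
  (z.1 * w.1 - z.2 * w.2, z.1 * w.2 + z.2 * w.1).
Definition Chorner (p : {poly R}) (z : R * R) : R * R :=
  foldr (fun c acc => let m := Cmul acc z in (m.1 + c, m.2)) (0, 0) (polyseq p).

Definition pencil_poly (n : nat) (E A : 'M[R]_n) : {poly R} :=
  \det ('X *: map_mx polyC E - map_mx polyC A).

Definition desc_stable (n : nat) (E A : 'M[R]_n) : Prop :=
  forall a b : R, Chorner (pencil_poly E A) (a, b) = (0, 0) -> Rlt a R0.

Definition full_rank_decomp (n r : nat) (E : 'M[R]_n) (X Y : 'M[R]_(n, r)) : Prop :=
  \rank X = r /\ \rank Y = r /\ E = X *m Y^T.

Definition Etilde (n r : nat) (A : 'M[R]_n) (X Y : 'M[R]_(n, r)) : 'M[R]_r :=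
  Y^T *m invmx A *m X.

Definition ctrb_mx (r : nat) (M : 'M[R]_r) (g : 'cV[R]_r) : 'M[R]_r :=
  \matrix_(i < r, j < r) (mxpow M j *m g) i 0.
Definition controllable (r : nat) (M : 'M[R]_r) (g : 'cV[R]_r) : Prop :=
  \rank (ctrb_mx M g) = r.
Definition obsv_mx (r : nat) (c : 'rV[R]_r) (M : 'M[R]_r) : 'M[R]_r :=
  \matrix_(i < r, j < r) (c *m mxpow M i) 0 j.
Definition observable (r : nat) (c : 'rV[R]_r) (M : 'M[R]_r) : Prop :=
  \rank (obsv_mx c M) = r.

Definition vnorm (n : nat) (v : 'cV[R]_n) : R := sqrt (\sum_(i < n) (v i 0) ^+ 2).

Definition sel (T : Type) (k : nat) (a b : T) : T := if k == 1%N then a else b.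

Definition locally_const (sigma : R -> nat) (t : R) : Prop :=
  exists d : R, Rlt R0 d /\ forall s : R, Rlt (Rabs (Rminus s t)) d -> sigma s = sigma t.

Definition piecewise_constant (sigma : R -> nat) : Prop :=
  forall a b : R, exists l : list R,
    forall t : R, Rle a t -> Rle t b -> ~ List.In t l -> locally_const sigma t.

Definition left_mode (sigma : R -> nat) (t : R) (i : nat) : Prop :=
  exists d : R, Rlt R0 d /\ forall s : R, Rlt (Rminus t d) s -> Rlt s t -> sigma s = i.
Definition right_mode (sigma : R -> nat) (t : R) (j : nat) : Prop :=
  exists d : R, Rlt R0 d /\ forall s : R, Rlt t s -> Rlt s (Rplus t d) -> sigma s = j.

Definition left_lim (n : nat) (x : R -> 'cV[R]_n) (t : R) (v : 'cV[R]_n) : Prop :=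
  forall eps : R, Rlt R0 eps -> exists d : R, Rlt R0 d /\
    forall s : R, Rlt (Rminus t d) s -> Rlt s t -> Rlt (vnorm (x s - v)) eps.
Definition right_lim (n : nat) (x : R -> 'cV[R]_n) (t : R) (v : 'cV[R]_n) : Prop :=
  forall eps : R, Rlt R0 eps -> exists d : R, Rlt R0 d /\
    forall s : R, Rlt t s -> Rlt s (Rplus t d) -> Rlt (vnorm (x s - v)) eps.

Definition has_deriv (n : nat) (x : R -> 'cV[R]_n) (t : R) (dx : 'cV[R]_n) : Prop :=
  forall i : 'I_n, derivable_pt_lim (fun s => x s i 0) t (dx i 0).

(* (sigma, x) is a solution on [t0, oo) of the switched system
   E_sigma x' = A_sigma x, sigma(t) in {1,2}, satisfying the jump rule
   Y_j^T x(t+) = Y_i^T x(t-) when sigma switches from i to j.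
   Convention: at a switching time t, x(t) = x(t+) (right-continuity). *)
Definition is_solution (n r : nat) (E1 A1 E2 A2 : 'M[R]_n) (Y1 Y2 : 'M[R]_(n, r))
    (t0 : R) (sigma : R -> nat) (x : R -> 'cV[R]_n) : Prop :=
  (forall t : R, sigma t = 1%N \/ sigma t = 2%N) /\
  piecewise_constant sigma /\
  right_lim x t0 (x t0) /\
  (forall t : R, Rlt t0 t -> locally_const sigma t ->
     exists dx : 'cV[R]_n, has_deriv x t dx /\
       sel (sigma t) E1 E2 *m dx = sel (sigma t) A1 A2 *m x t) /\
  (forall t : R, Rlt t0 t -> ~ locally_const sigma t ->
     exists (xm : 'cV[R]_n) (i j : nat),
       left_lim x t xm /\ right_lim x t (x t) /\
       left_mode sigma t i /\ right_mode sigma t j /\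
       (sel j Y1 Y2)^T *m x t = (sel i Y1 Y2)^T *m xm).

Definition GUES (n r : nat) (E1 A1 E2 A2 : 'M[R]_n) (Y1 Y2 : 'M[R]_(n, r)) : Prop :=
  exists beta alpha : R, Rlt R0 beta /\ Rlt R0 alpha /\
    forall (t0 : R) (sigma : R -> nat) (x : R -> 'cV[R]_n),
      is_solution E1 A1 E2 A2 Y1 Y2 t0 sigma x ->
      forall t : R, Rle t0 t ->
        Rle (vnorm (x t)) (Rmult (Rmult beta (exp (Ropp (Rmult alpha (Rminus t t0))))) (vnorm (x t0))).

(* Main.v *)
Require Import Defs.
From HB Require Import structures.
From Stdlib Require Import Reals ClassicalEpsilon FunctionalExtensionality.
From Stdlib Require Lra.
From mathcomp Require Import all_boot all_order all_algebra.
From mathcomp Require Import zify ring lra.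
From mathcomp Require Import polyrcf complex.
Set Implicit Arguments. Unset Strict Implicit. Unset Printing Implicit Defensive.
Import Order.TTheory GRing.Theory Num.Theory.
Local Open Scope ring_scope.

(** In the variable [z = Y_i^T x] mode [i] reads [T_i z' = z] with
    [T_i = Y_i^T A_i^-1 X_i], and [z] is continuous across switches.  Hence a
    matrix [P > 0] with [2 v^T P T_i v <= - k |T_i v|^2] for both modes makes
    [z^T P z] decay exponentially along every solution; the index conditions
    give [x = G_i z], so that [x] decays as well.

    To find [P], write [T_2 = T_1 - g h^T], [a = det (s - T_1)],
    [c = det (s - T_2)], and let [w] be a flat output of [z' = T_1 z + g u], so
    that [a(D) w = u] and [c(D) w = u + h^T z]; the modes are [a(D) w = 0] and
    [c(D) w = 0].  By the matrix determinant lemma,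
    [a(s) c(-s) + a(-s) c(s) = 2 f(-s^2)] with [f(y) = det (y + T_1 T_2)], and
    condition (d) says [f(y) = y q(y)] with [q > 0] on [[0, oo)].  Such a [q]
    stays nonnegative after subtracting a small multiple of
    [1 + y + ... + y^(r-1)], and a polynomial nonnegative on the half line is a
    sum of terms [e(s) e(-s)] at [y = -s^2]; so [2 f(-s^2)] is a sum of
    [d(s) d(-s)], where the [d] include positive multiples of [s, ..., s^r].
    Therefore [c(s) a(t) + a(s) c(t) - \sum d(s) d(t)] is divisible by
    [s + t]; the quotient is the matrix of a quadratic form whose derivative
    is [2 (a(D) w) (c(D) w) - \sum (d(D) w)^2].  Positivity of [P] follows from
    the stability of mode 1 by the inertia argument for Lyapunov equations. *)

(** * The ordered field of reals *)

Definition R_leb (x y : R) : bool := if Rle_dec x y then true else false.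
Definition R_ltb (x y : R) : bool := (y != x) && R_leb x y.

Lemma R_lebP x y : reflect (Rle x y) (R_leb x y).
Proof. by rewrite /R_leb; case: Rle_dec => ?; constructor. Qed.

Lemma R_le0_add x y : R_leb 0 x -> R_leb 0 y -> R_leb 0 (x + y).
Proof. by move=> /R_lebP ? /R_lebP ?; apply/R_lebP/Rplus_le_le_0_compat. Qed.

Lemma R_le0_mul x y : R_leb 0 x -> R_leb 0 y -> R_leb 0 (x * y).
Proof. by move=> /R_lebP ? /R_lebP ?; apply/R_lebP/Rmult_le_pos. Qed.

Lemma R_le0_anti x : R_leb 0 x -> R_leb x 0 -> x = 0.
Proof. by move=> /R_lebP ? /R_lebP ?; apply: Rle_antisym. Qed.

Lemma R_sub_ge0 x y : R_leb 0 (y - x) = R_leb x y.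
Proof.
apply/R_lebP/R_lebP => [h|h]; first exact/Rge_le/Rminus_ge/Rle_ge.
exact/Rge_le/Rge_minus/Rle_ge.
Qed.

Lemma R_le0_total x : R_leb 0 x || R_leb x 0.
Proof.
by case: (Rle_or_lt 0 x) => [|/Rlt_le] /R_lebP ->; rewrite ?orbT.
Qed.

Lemma R_ge0_norm x : R_leb 0 x -> Rabs x = x.
Proof. by move=> /R_lebP /Rabs_pos_eq. Qed.

HB.instance Definition _ := Num.IntegralDomain_isLeReal.Build R
  R_le0_add R_le0_mul R_le0_anti R_sub_ge0 R_le0_total Rabs_Ropp R_ge0_norm
  (fun x y => erefl (R_ltb x y)).

Lemma RleP x y : reflect (Rle x y) (x <= y).
Proof. exact: R_lebP. Qed.

Lemma RltP x y : reflect (Rlt x y) (x < y).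
Proof.
rewrite lt_def; apply: (iffP andP) => [[/eqP nyx /RleP]|xy].
  by case=> // /esym.
by split; [apply/eqP/Rgt_not_eq | apply/RleP/Rlt_le].
Qed.

Lemma continuity_pt_ext f g x : f =1 g -> continuity_pt f x -> continuity_pt g x.
Proof.
move=> fg; apply: (@continuity_pt_locally_ext _ _ R1); first exact: Rlt_0_1.
by move=> y _; exact: fg.
Qed.

Lemma horner_continuity (p : {poly R}) : continuity (horner p).
Proof.
move=> x; elim/poly_ind: p => [|p c IHp].
  apply: (@continuity_pt_ext (fun=> 0)); first by move=> y; rewrite horner0.
  exact: continuity_pt_const.
apply: (@continuity_pt_ext (fun y => Rplus (Rmult p.[y] y) c)).
  by move=> y; rewrite hornerMXaddC.
apply: continuity_pt_plus; last exact: continuity_pt_const.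
apply: continuity_pt_mult => //.
exact/derivable_continuous_pt/derivable_pt_id.
Qed.

Lemma R_real_closed : Num.real_closed_axiom R.
Proof.
move=> p a b ab /andP[pa pb].
(* [IVT] takes strict signs at the endpoints, so a zero at an endpoint is split off first. *)
have [pa0|pa0] := eqVneq p.[a] 0; first by exists a; rewrite ?lexx //; apply/eqP.
have [pb0|pb0] := eqVneq p.[b] 0.
  by exists b; rewrite ?lexx ?andbT //; apply/eqP.
have ltab : a < b.
  rewrite lt_neqAle ab andbT; apply: contraNneq pa0 => abE.
  by rewrite eq_le pa abE pb.
case: (@IVT (horner p) a b); first exact: horner_continuity.
- exact/RltP.
- by apply/RltP; rewrite lt_neqAle pa0.
- by apply/RltP; rewrite lt_def pb0.
by move=> z [[/RleP az /RleP zb] pz]; exists z; [rewrite az | apply/eqP].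
Qed.
HB.instance Definition _ := Num.RealField_isClosed.Build R R_real_closed.

(** The one consequence of compactness used in the algebra. As a hypothesis it lets the sum of
    squares results run over an arbitrary real closed field. *)
Definition min_attained (F : rcfType) := forall p : {poly F},
  (forall x, 0 <= x -> 0 <= p.[x]) ->
  exists2 u, 0 <= u & forall x, 0 <= x -> p.[u] <= p.[x].

Lemma lead_coef_ge0 (F : rcfType) (p : {poly F}) :
  (forall x, 0 <= x -> 0 <= p.[x]) -> 0 <= lead_coef p.
Proof.
move=> p_ge0; rewrite leNgt; apply/negP => lp.
have [|n hn] := @poly_pinfty_gt_lc _ (- p); first by rewrite lead_coefN oppr_gt0.
have /p_ge0 : 0 <= Num.max 0 n by rewrite le_max lexx.
rewrite leNgt; have: - lead_coef p <= (- p).[Num.max 0 n].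
  by rewrite -lead_coefN; apply: hn; rewrite le_max lexx orbT.
by rewrite hornerN lerN2 => /le_lt_trans ->.
Qed.

(** Beyond some [b] the polynomial is at least [p.[0]], so the minimum over the compact interval
    [[0, b]] is a minimum over the half line. *)
Lemma R_min_attained : min_attained R.
Proof.
move=> p p_ge0; have [p1|p1] := leqP (size p) 1%N.
  exists 0 => // x _.
  by rewrite (size1_polyC p1) !hornerC.
have lp : 0 < lead_coef p.
  by rewrite lt_def lead_coef_ge0 // lead_coef_eq0 -size_poly_gt0 (leq_trans _ p1).
have [n hn] := poly_lim_infty p.[0] lp p1.
pose b : R := Num.max 0 n.
have b0 : Rle 0 b by apply/RleP; rewrite le_max lexx.
have [u [hu [/RleP u0 _]]] := @continuity_ab_min (horner p) 0 b b0
  (fun c _ => horner_continuity p c).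
exists u => // x x0; have [xb|xb] := leP x b.
  by apply/RleP/hu; split; apply/RleP.
apply: (@le_trans _ _ p.[0]); first by apply/RleP/hu; split => //; exact: Rle_refl.
by apply/hn/ltW/(le_lt_trans _ xb); rewrite le_max lexx orbT.
Qed.

(** * Sums of squares on the half line *)

Section Sos.
Context {F : rcfType}.
Implicit Types (p q f : {poly F}) (u x : F).

Lemma horner_lim_ge0 p u :
  (forall d, 0 < d -> exists2 y, `|y - u| < d & 0 <= p.[y]) -> 0 <= p.[u].
Proof.
move=> h; rewrite leNgt; apply/negP => pu.
have [|d d0 hd] := @poly_cont _ u p (- p.[u]); first by rewrite oppr_gt0.
have [y /hd yu py] := h d d0.
move: yu; rewrite ltr_norml => /andP[_]; lra.
Qed.

Lemma root_size p u : root p u -> exists2 g, p = g * ('X - u%:P) &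
  size g = (size p).-1.
Proof.
move=> /factor_theorem[g ->]; exists g => //.
have [->|g0] := eqVneq g 0; first by rewrite mul0r size_poly0.
by rewrite size_Mmonic ?monicXsubC // size_XsubC addn2.
Qed.

(** A minimum at an interior point [u > 0] is a double root of [f - f.[u]]; at the boundary point
    [u = 0] a single factor ['X] is split off. In both cases the removed factor is nonnegative on
    the half line, and so is the cofactor. *)
Lemma min_factor f u : 0 <= u -> (1 < size f)%N ->
  (forall x, 0 <= x -> f.[u] <= f.[x]) ->
  exists g, [/\ forall x, 0 <= x -> 0 <= g.[x] &
    (f = f.[u]%:P + g * 'X /\ size g = (size f).-1) \/
    (f = f.[u]%:P + g * ('X - u%:P) ^+ 2 /\ size g = (size f).-2)].
Proof.
move=> u0 sf fmin; pose c := f.[u].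
have [|g1 fE sg1] := @root_size (f - c%:P) u.
  by rewrite /root !hornerE subrr.
have {}sg1 : size g1 = (size f).-1.
  by rewrite sg1 -polyCN size_polyDl // (leq_ltn_trans (size_polyC_leq1 _)).
have {}fE : f = c%:P + g1 * ('X - u%:P) by rewrite -fE addrC subrK.
have fx x : f.[x] - c = g1.[x] * (x - u).
  by rewrite [in LHS]fE !hornerE addrAC subrr add0r.
have g1r x : u < x -> 0 <= g1.[x].
  move=> ux; rewrite -(pmulr_lge0 _ (_ : 0 < x - u)) ?subr_gt0 // -fx subr_ge0.
  exact/fmin/ltW/(le_lt_trans u0).
have near_r d : 0 < d -> exists2 y, u < y & `|y - u| < d.
  move=> d0; have d2 : 0 < d / 2 by rewrite divr_gt0.
  exists (u + d / 2); first by rewrite ltrDl.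
  by rewrite addrC addKr gtr0_norm // ltr_pdivrMr // ltr_pMr // ltr1n.
have g1u : 0 <= g1.[u].
  by apply: horner_lim_ge0 => d /near_r[y /g1r ? ?]; exists y.
have [u00|un0] := eqVneq u 0.
  exists g1; split=> [x|]; last by left; split=> //; rewrite -/c {1}fE u00 polyC0 subr0.
  by rewrite le_eqVlt -{1 2}u00 => /orP[/eqP <-|/g1r].
have {un0}u_gt0 : 0 < u by rewrite lt_def un0.
have g1l x : 0 <= x < u -> g1.[x] <= 0.
  move=> /andP[x0 xu]; rewrite -oppr_ge0 -(pmulr_lge0 _ (_ : 0 < u - x)) ?subr_gt0 //.
  by have := fmin x x0; rewrite -subr_ge0 fx; lra.
(* The quotient [g1] is nonpositive to the left of [u] and nonnegative to the right; continuity
   forces a second root at [u]. *)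
have {}g1u : root g1 u.
  apply/eqP/le_anti; rewrite g1u andbT -oppr_ge0 -hornerN.
  apply: horner_lim_ge0 => d d0; pose e := Num.min u d / 2.
  have m0 : 0 < Num.min u d by rewrite lt_min u_gt0.
  have mu : Num.min u d <= u by rewrite ge_min lexx.
  have md : Num.min u d <= d by rewrite ge_min lexx orbT.
  exists (u - e); first by rewrite addrAC subrr add0r normrN ger0_norm /e; lra.
  by rewrite hornerN oppr_ge0 g1l // /e; lra.
have [g g1E sg] := root_size g1u.
have g1x x : g1.[x] = g.[x] * (x - u) by rewrite g1E !hornerE.
have gr x : u < x -> 0 <= g.[x].
  by move=> ux; have := g1r _ ux; rewrite g1x pmulr_lge0 ?subr_gt0.
exists g; split=> [x x0|]; last first.
  by right; rewrite {1}fE {1}g1E exprS expr1 mulrA sg sg1.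
case: (ltgtP x u) => [xu|/gr //|->].
  by have := g1l x; rewrite x0 xu g1x => /(_ isT); rewrite nmulr_lle0 ?subr_lt0.
by apply: horner_lim_ge0 => d /near_r[y /gr ? ?]; exists y.
Qed.

(* Evaluated at [s = i w], the products [e(s) e(-s)] are the squares [|e(i w)|^2]. *)
Lemma nonneg_sos f : min_attained F -> (forall x, 0 <= x -> 0 <= f.[x]) ->
  exists2 es : seq {poly F}, f \Po (- 'X^2) = \sum_(e <- es) e * (e \Po - 'X) &
    forall e, e \in es -> (size e <= size f)%N.
Proof.
move=> Fmin; have [k] := ubnP (size f); elim: k => // k IHk in f *.
rewrite ltnS => sfk f_ge0; have [u u0 fmin] := Fmin f f_ge0.
pose c := Num.sqrt f.[u].
have cE : f.[u]%:P = c%:P * (c%:P \Po - 'X).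
  by rewrite comp_polyC -polyCM -expr2 sqr_sqrtr ?f_ge0.
have [sf|sf] := leqP (size f) 1%N.
  exists [:: c%:P] => [|e].
    rewrite big_seq1 -cE (size1_polyC sf) hornerC comp_polyC //.
  rewrite inE => /eqP ->; rewrite /c (size1_polyC sf) hornerC !size_polyC.
  by case: (eqVneq f`_0 0) => [->|_]; rewrite ?leq_b1 // sqrtr0 eqxx.
(* At [y = -s^2] the factor removed by [min_factor] has the form [m(s) m(-s)], with [m = s] for [y]
   up to the order of signs and [m = s^2 + u] for [(y - u)^2]. It is absorbed into every [e] found
   for [g]; the minimum value contributes its square root [c]. *)
have step (g m : {poly F}) : (size g < size f)%N ->
    (forall x, 0 <= x -> 0 <= g.[x]) -> (size m <= (size f - size g).+1)%N ->
    f \Po (- 'X^2) = f.[u]%:P + (g \Po (- 'X^2)) * (m * (m \Po - 'X)) ->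
    exists2 es : seq {poly F}, f \Po (- 'X^2) = \sum_(e <- es) e * (e \Po - 'X) &
    forall e, e \in es -> (size e <= size f)%N.
  move=> sg g0 sm ->; have [es gE ses] := IHk g (leq_trans sg sfk) g0.
  exists (c%:P :: [seq e * m | e <- es]) => [|e].
    rewrite big_cons big_map -cE gE mulr_suml; congr (_ + _).
    by apply: eq_bigr => e _; rewrite comp_polyM; ring.
  rewrite inE => /orP[/eqP ->|/mapP[d /ses sd ->]].
    exact: leq_trans (size_polyC_leq1 _) (ltnW sf).
  rewrite (leq_trans (size_polyMleq _ _)) //.
  rewrite -(subnKC (ltnW sg)) -ltnS (leq_trans _ (_ : size g + (size f - size g).+1 <= _)%N) //.
    case: (_ + _)%N (leq_add sd sm) => // *; lia.
  lia.
have [g [g0 [[fE sg]|[fE sg]]]] := min_factor u0 sf fmin.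
  apply: (step g 'X) => //; rewrite ?sg ?size_polyX.
  - by rewrite prednK // (leq_trans _ sf).
  - lia.
  rewrite {1}fE comp_polyD comp_polyC comp_polyM comp_polyX; congr (_ + _ * _).
  by rewrite comp_polyX; ring.
apply: (step g ('X^2 + u%:P)) => //; rewrite ?sg.
- lia.
- rewrite size_polyDl ?size_polyXn //; first lia.
  exact: leq_ltn_trans (size_polyC_leq1 _) _.
rewrite {1}fE comp_polyD comp_polyC comp_polyM; congr (_ + _ * _).
rewrite rmorphXn /= comp_polyB comp_polyX comp_polyC comp_polyD comp_polyC.
by rewrite rmorphXn /= comp_polyX; ring.
Qed.

(** Far out, [q] dominates a small multiple of the geometric sum because the degrees agree; on the
    remaining bounded interval the positive minimum of [q] is compared with the largest value of the
    sum. *)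
Lemma pos_sub_geom_ge0 q r : min_attained F -> (forall x, 0 <= x -> 0 < q.[x]) ->
  size q = r -> exists2 eps : F, 0 < eps &
    forall x, 0 <= x -> 0 <= (q - eps *: \sum_(k < r) 'X^k).[x].
Proof.
move=> Fmin q_gt0 sq; pose S : {poly F} := \sum_(k < r) 'X^k.
have [|u u0 qmin] := Fmin q; first by move=> x /q_gt0/ltW.
have Sge0 x : 0 <= x -> 0 <= S.[x].
  by move=> x0; rewrite horner_sum sumr_ge0 // => k _; rewrite hornerXn exprn_ge0.
have lq : 0 < lead_coef q.
  rewrite lt_def lead_coef_ge0 ?andbT; last by move=> x /q_gt0/ltW.
  by rewrite lead_coef_eq0; apply/eqP => q0; have := q_gt0 _ (lexx 0); rewrite q0 horner0 ltxx.
have r_gt0 : (0 < r)%N by rewrite -sq size_poly_gt0 -lead_coef_eq0 gt_eqF.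
have Scoef i : (i < r)%N -> S`_i = 1.
  move=> ir; rewrite coef_sum (bigD1 (Ordinal ir)) //= coefXn eqxx big1 ?addr0 //.
  by move=> j ji; rewrite coefXn; case: eqVneq => // ij; rewrite -val_eqE /= ij eqxx in ji.
have Ssize : (size S <= r)%N.
  by rewrite (leq_trans (size_sum _ _ _)) //; apply/bigmax_leqP => i _; rewrite size_polyXn.
(* With half the leading coefficient of [q], the difference [q - l *: S] keeps the positive leading
   coefficient [l]. *)
pose l := lead_coef q / 2; have l0 : 0 < l by rewrite /l divr_gt0.
have lqS : lead_coef (q - l *: S) = l.
  have cr : (q - l *: S)`_r.-1 = l.
    rewrite coefB coefZ Scoef ?prednK // -sq -lead_coefE mulr1 /l; lra.
  rewrite lead_coefE; suff -> : size (q - l *: S) = r by [].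
  apply/eqP; rewrite eqn_leq; apply/andP; split.
    rewrite (leq_trans (size_polyD _ _)) // geq_max sq leqnn size_polyN.
    exact: leq_trans (size_scale_leq _ _) Ssize.
  rewrite -(prednK r_gt0) ltnNge; apply/negP => /leq_sizeP/(_ _ (leqnn _))/eqP.
  by rewrite cr gt_eqF.
have [|n hn] := @poly_pinfty_gt_lc _ (q - l *: S); first by rewrite lqS.
pose m := Num.max 0 n; have m0 : 0 <= m by rewrite le_max lexx.
have Smono x : 0 <= x <= m -> S.[x] <= S.[m].
  move=> /andP[x0 xm]; rewrite !horner_sum ler_sum // => k _.
  by rewrite !hornerXn lerXn2r.
have S0 := Sge0 _ m0; have qu := q_gt0 _ u0.
(* Chosen so that [e * S.[m]] is at most the minimum [q.[u]]. *)
pose e := q.[u] / (1 + S.[m]).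
have e0 : 0 < e by rewrite divr_gt0 // ltr_pwDl.
exists (Num.min l e) => [|x x0]; first by rewrite lt_min l0.
rewrite hornerD hornerN hornerZ subr_ge0.
have [xm|mx] := leP x m.
  apply: le_trans (qmin x x0); apply: (@le_trans _ _ (e * S.[m])).
    apply: ler_pM; rewrite ?Sge0 ?Smono ?x0 ?xm // ?ge_min ?lexx ?orbT //.
    by rewrite le_min !ltW.
  rewrite /e -mulrA ler_piMr ?(ltW qu) // mulrC ler_pdivrMr ?mul1r ?lerDr //.
  by rewrite ltr_pwDl.
have := hn x; rewrite lqS hornerD hornerN hornerZ => /(_ _)/(le_trans (ltW l0)).
rewrite subr_ge0 => h; apply: (@le_trans _ _ (l * S.[x])).
  by rewrite ler_wpM2r ?Sge0 // ge_min lexx.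
by apply: h; rewrite (le_trans _ (ltW mx)) // le_max lexx orbT.
Qed.
End Sos.

(** * Lyapunov equations and inertia *)

Section Lyapunov.
Local Open Scope sesquilinear_scope.
Context {C : numClosedFieldType}.

Lemma trmxC_mul m n p (A : 'M[C]_(m, n)) (B : 'M_(n, p)) :
  (A *m B)^t* = B^t* *m A^t*.
Proof. by rewrite trmx_mul map_mxM. Qed.

Lemma mul11 (A B : 'M[C]_1) : (A *m B) 0 0 = A 0 0 * B 0 0.
Proof. by rewrite mxE big_ord1. Qed.

Definition herm_pos n (P : 'M[C]_n) :=
  forall v : 'cV_n, v != 0 -> 0 < (v^t* *m P *m v) 0 0.

Lemma herm_pos_unit n (P : 'M[C]_n) : herm_pos P -> P \in unitmx.
Proof.
move=> Ppos; rewrite unitmxE unitfE; apply/negP => /det0P[v v0 vP].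
have := Ppos (v^t* ); rewrite trmxCK vP mul0mx mxE ltxx.
suff v0' : v^t* != 0 by move/(_ v0').
by apply: contraNneq v0 => vt0; rewrite -[v]trmxCK vt0 trmx0 map_mx0.
Qed.

(** Negative definiteness of the Lyapunov expression [T^t* P + P T]. *)
Definition lyap_neg n (T P : 'M[C]_n) := forall v : 'cV_n, v != 0 ->
  ((T *m v)^t* *m P *m v + v^t* *m P *m (T *m v)) 0 0 < 0.

Lemma col_mx_t m1 m2 (u : 'cV[C]_m1) (w : 'cV[C]_m2) :
  (col_mx u w)^t* = row_mx (u^t* ) (w^t* ).
Proof. by rewrite tr_col_mx map_row_mx. Qed.

(* One step of the inertia theorem: the last vectors span an invariant
   subspace, and its [P]-orthogonal complement sees the diagonal entry [l]. *)
Lemma herm_pos_block n (p l : 'M[C]_1) (b c : 'cV[C]_n) (P T : 'M[C]_n) :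
  p^t* = p -> P^t* = P -> herm_pos P -> l 0 0 + (l 0 0)^* < 0 ->
  lyap_neg (block_mx l 0 c T) (block_mx p (b^t* ) b P) ->
  herm_pos (block_mx p (b^t* ) b P).
Proof.
move=> ph Ph Ppos lneg Tneg; have Pu := herm_pos_unit Ppos.
(* The vector [u = (1, - k)] defined below is [P]-orthogonal to the trailing coordinates, and the
   Schur complement [d] is the value of the form at [u]. *)
pose k : 'cV_n := invmx P *m b; have Pk : P *m k = b by rewrite mulKVmx.
have kP : k^t* *m P = b^t* by rewrite -{1}Ph -trmxC_mul Pk.
pose d := p - b^t* *m k.
have dh : d^t* = d.
  by rewrite /d linearB /= map_mxB ph trmxC_mul trmxCK -[in RHS]kP -mulmxA Pk.
pose u : 'cV_(1 + n) := col_mx 1%:M (- k).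
have PuE : block_mx p (b^t* ) b P *m u = col_mx d 0.
  by rewrite mul_block_col !mulmx1 !mulmxN Pk subrr.
have uPE : u^t* *m block_mx p (b^t* ) b P = row_mx d 0.
  rewrite col_mx_t mul_row_block linearN /= map_mxN !mulNmx kP.
  rewrite trmx1 map_scalar_mx /= rmorph1 !mul1mx subrr /d; congr (row_mx (_ - _) _).
  by rewrite -kP -mulmxA Pk.
have d0 : 0 < d 0 0.
  have u0 : u != 0.
    apply/eqP => /(congr1 usubmx); rewrite col_mxKu linear0 => /matrixP/(_ 0 0).
    by rewrite !mxE /= => /eqP; rewrite oner_eq0.
  have := Tneg u u0; rewrite uPE -mulmxA PuE.
  rewrite mul_block_col mul0mx addr0 mulmx1 col_mx_t !mul_row_col mulmx0 mul0mx.
  rewrite !addr0 mxE !mul11 [_ * l 0 0]mulrC -mulrDl.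
  by move: (d 0 0) => d00; rewrite !mxE addrC nmulr_rlt0.
move=> v; rewrite -[v]vsubmxK; move: (usubmx v) (dsubmx v) => a w v0.
pose w' := w + k *m a.
have vE : col_mx a w = u *m a + col_mx 0 w'.
  by rewrite mul_col_mx mul1mx add_col_mx addr0 mulNmx /w' addrC addrK.
have -> : ((col_mx a w)^t* *m block_mx p (b^t* ) b P *m col_mx a w) 0 0 =
   (a^t* *m d *m a) 0 0 + (w'^t* *m P *m w') 0 0.
  set M := block_mx _ _ _ _; set w0 : 'cV_(1 + n) := col_mx 0 w'.
  have uMu : u^t* *m M *m u = d by rewrite uPE mul_row_col mulmx1 mul0mx addr0.
  have uMw : u^t* *m M *m w0 = 0 by rewrite uPE mul_row_col mulmx0 mul0mx addr0.
  have w0t : w0^t* = row_mx 0 (w'^t* ) by rewrite col_mx_t trmx0 map_mx0.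
  have wMu : w0^t* *m M *m u = 0.
    by rewrite -mulmxA PuE w0t mul_row_col mul0mx mulmx0 addr0.
  have wMw : w0^t* *m M *m w0 = w'^t* *m P *m w'.
    by rewrite w0t mul_row_block !mul0mx !add0r mul_row_col mulmx0 add0r.
  have -> : (col_mx a w)^t* = a^t* *m u^t* + w0^t*.
    by rewrite vE -trmxC_mul -map_mxD -linearD.
  rewrite vE; set e := u *m a + _.
  have -> : (a^t* *m u^t* + w0^t* ) *m M *m e =
      a^t* *m (u^t* *m M *m u) *m a + a^t* *m (u^t* *m M *m w0) +
      (w0^t* *m M *m u *m a + w0^t* *m M *m w0).
    by rewrite /e !(mulmxDl, mulmxDr) !mulmxA.
  by rewrite uMu uMw wMu wMw mulmx0 mul0mx addr0 add0r [LHS]mxE.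
have aE : (a^t* *m d *m a) 0 0 = `|a 0 0| ^+ 2 * d 0 0.
  by rewrite !mul11; move: (d 0 0) => d00; rewrite !mxE normCK; ring.
have a_ge0 : 0 <= (a^t* *m d *m a) 0 0 by rewrite aE mulr_ge0 ?exprn_ge0 // ltW.
have [w0|w0] := eqVneq w' 0; last by rewrite ltr_wpDl // Ppos.
rewrite w0 mulmx0 [X in _ + X]mxE addr0 lt_def a_ge0 andbT.
have a0 : a 0 0 != 0.
  apply: contraNneq v0 => a00; have a0 : a = 0 by apply/matrixP => i j; rewrite !ord1 a00 mxE.
  by rewrite a0 -[w](addrK (k *m a)) -/w' w0 a0 mulmx0 subr0 col_mx0.
by rewrite aE; apply: mulf_neq0; [rewrite expf_neq0 ?normr_eq0 | rewrite gt_eqF].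
Qed.

(** [T] is lower triangular, so the vectors with zero first coordinate form an invariant subspace.
    Induction handles their block, and [herm_pos_block] adds the first coordinate. *)
Lemma trig_lyap_pos n (T P : 'M[C]_n) : is_trig_mx T -> P^t* = P ->
  (forall i, T i i + (T i i)^* < 0) -> lyap_neg T P -> herm_pos P.
Proof.
elim: n T P => [|n IHn] T P Ttr Ph Td TP.
  by move=> v; rewrite (flatmx0 v) eqxx.
pose T' : 'M_(1 + n) := T; pose P' : 'M_(1 + n) := P.
have Ph' : P'^t* = P' by [].
have PE : P' = block_mx (ulsubmx P') ((dlsubmx P')^t* ) (dlsubmx P') (drsubmx P').
  rewrite -[LHS]submxK; congr block_mx.
  by rewrite trmx_dlsub map_ursubmx Ph'.
have TE : T' = block_mx (ulsubmx T') 0 (dlsubmx T') (drsubmx T').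
  rewrite -[LHS]submxK; congr block_mx; apply/matrixP => i j; rewrite !mxE.
  by apply: (is_trig_mxP Ttr); rewrite ord1.
have drh : (drsubmx P')^t* = drsubmx P'.
  by rewrite trmx_drsub map_drsubmx Ph'.
have drneg : lyap_neg (drsubmx T') (drsubmx P').
  have Tc (w : 'cV_n) : T' *m col_mx 0 w = col_mx 0 (drsubmx T' *m w).
    by rewrite {1}TE mul_block_col !mulmx0 mul0mx !add0r.
  have Pc (v w : 'cV_n) :
      (col_mx 0 v)^t* *m P' *m col_mx 0 w = v^t* *m drsubmx P' *m w.
    rewrite {1}PE col_mx_t trmx0 map_mx0 mul_row_block !mul0mx !add0r.
    by rewrite mul_row_col mulmx0 add0r.
  have TP' : lyap_neg T' P' by [].
  move=> w w0; have := TP' (col_mx 0 w); rewrite Tc !Pc; apply.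
  by apply: contra w0 => /eqP/(congr1 dsubmx); rewrite col_mxKd linear0 => ->.
have drpos : herm_pos (drsubmx P').
  apply: (IHn (drsubmx T')) => // [|i].
    apply/is_trig_mxP => i j ij; rewrite !mxE.
    by apply: (is_trig_mxP Ttr); rewrite /= ltn_add2l.
  by rewrite !mxE Td.
rewrite -[P]/P' PE; apply: (herm_pos_block (l := ulsubmx T') (c := dlsubmx T') (T := drsubmx T')) => //.
- by rewrite trmx_ulsub map_ulsubmx Ph'.
- by rewrite !mxE Td.
by rewrite -PE -TE.
Qed.

(** A unitary Schur basis makes [A] triangular with its eigenvalues on the diagonal; the hypotheses
    on [P] and the conclusion are carried along by the unitary congruence. *)
Lemma hurwitz_lyap_pos n (A P : 'M[C]_n) : P^t* = P ->
  (forall l, eigenvalue A l -> l + l^* < 0) -> lyap_neg A P -> herm_pos P.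
Proof.
case: n A P => [|n] A P Ph Aeig AP; first by move=> v; rewrite (flatmx0 v) eqxx.
have [U Uu] := Schur A (ltn0Sn n); rewrite /similar_to /= => Utr.
have Uun := unitarymx_unit Uu; rewrite conjumx // in Utr.
have VE := invmx_unitary Uu; pose V := invmx U.
have Vt : V^t* = U by rewrite /V VE trmxCK.
have Ut : U^t* = V by rewrite /V VE.
have VU : V *m U = 1%:M by rewrite mulVmx.
have UV : U *m V = 1%:M by rewrite mulmxV.
pose T := U *m A *m V.
have Ppos : herm_pos (U *m P *m V).
  apply: (@trig_lyap_pos _ T) => // [|i|v v0].
  - by rewrite !trmxC_mul Ut Vt Ph mulmxA.
  - apply: Aeig; have : eigenvalue T (T i i).
      rewrite eigenvalue_root_char char_poly_trig // (bigD1 i) //=.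
      by rewrite rootM root_XsubC eqxx.
    move=> /eigenvalueP[v vT v0]; apply/eigenvalueP; exists (v *m U).
      by rewrite scalemxAl -vT /T -!mulmxA VU mulmx1.
    apply: contra v0 => /eqP vU; by rewrite -[v]mulmx1 -UV mulmxA vU mul0mx.
  have : V *m v != 0.
    by apply: contra v0 => /eqP Vv; rewrite -[v]mul1mx -UV -mulmxA Vv mulmx0.
  move/AP; rewrite !trmxC_mul !Vt /T ?trmxC_mul ?Ut ?Vt !mulmxA.
  by rewrite -[_ *m V *m U]mulmxA VU mulmx1 -[_ *m V *m U]mulmxA VU mulmx1.
move=> v v0; have : U *m v != 0.
  by apply: contra v0 => /eqP Vv; rewrite -[v]mul1mx -VU -mulmxA Vv mulmx0.
move/Ppos; rewrite trmxC_mul Ut !mulmxA.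
by rewrite -[_ *m V *m U]mulmxA VU mulmx1 -[_ *m V *m U]mulmxA VU mulmx1.
Qed.
End Lyapunov.

(** * The inertia argument for real matrices *)

Section RealLyapunov.
Local Open Scope sesquilinear_scope.
Local Open Scope complex_scope.
Context {F : rcfType}.
Local Notation toC := (map_mx (real_complex F)).

Lemma conj_real (x : F) : (x%:C)^*%R = x%:C :> F[i].
Proof. by apply/conj_Creal; rewrite realE !lecR le_total. Qed.

Lemma real_trmxC m n (M : 'M[F]_(m, n)) : (toC M)^t* = toC M^T.
Proof. by apply/matrixP => i j; rewrite !mxE conj_real. Qed.

Lemma complex_mx m n (M : 'M[F[i]]_(m, n)) :
  M = toC (map_mx (@complex.Re F) M) + 'i *: toC (map_mx (@complex.Im F) M).
Proof.
apply/matrixP => i j; rewrite !mxE; case: (M i j) => a b /=.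
by apply/eqP; rewrite eq_complex /= !mul0r !mul1r !subr0 !addr0 !add0r !eqxx.
Qed.

Lemma complex_form n (P : 'M[F]_n) (x y z t : 'cV[F]_n) :
  (toC x + 'i *: toC y)^t* *m toC P *m (toC z + 'i *: toC t) =
  toC (x^T *m P *m z + y^T *m P *m t) +
  'i *: toC (x^T *m P *m t - y^T *m P *m z).
Proof.
have -> : (toC x + 'i *: toC y)^t* = toC x^T - 'i *: toC y^T.
  rewrite -!real_trmxC !linearD /= map_mxD linearZ /= map_mxZ; congr (_ + _).
  by rewrite -scaleNr; congr (_ *: _); exact: (@conjCi F[i]).
rewrite !mulmxDl !mulmxDr -!scalemxAr !mulNmx -!scalemxAl !map_mxD !map_mxN.
rewrite !map_mxM /= scalerDr scalerN !scalerA.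
rewrite (_ : 'i * 'i = -1 :> F[i]); last by rewrite -expr2 sqr_i.
rewrite scaleN1r opprK -!addrA; congr (_ + _).
by rewrite scalerN addrA addrC.
Qed.

(** For [v = x + i y] the complex Lyapunov form is twice the sum of the real forms at [x] and at
    [y], the imaginary cross terms cancelling by symmetry of [P]. So the real inequality extends to
    complex vectors. *)
Lemma hurwitz_real_lyap_pos n (A P : 'M[F]_n) : P^T = P ->
  (forall l, eigenvalue (toC A) l -> complex.Re l < 0) ->
  (forall v : 'cV_n, v != 0 -> (v^T *m P *m (A *m v)) 0 0 < 0) ->
  forall v : 'cV_n, v != 0 -> 0 < (v^T *m P *m v) 0 0.
Proof.
move=> Ps Aeig AP.
have AP0 (v : 'cV_n) : (v^T *m P *m (A *m v)) 0 0 <= 0.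
  by have [->|/AP/ltW //] := eqVneq v 0; rewrite !mulmx0 mxE.
have sym (x y : 'cV_n) : (x^T *m P *m y) 0 0 = (y^T *m P *m x) 0 0.
  rewrite (_ : x^T *m P *m y = (y^T *m P *m x)^T) ?mxE //.
  by rewrite !trmx_mul trmxK Ps mulmxA.
have Ppos : herm_pos (toC P).
  apply: (@hurwitz_lyap_pos _ _ (toC A)) => [|l /Aeig lneg|v v0].
  - by rewrite real_trmxC Ps.
  - rewrite (_ : l + l^*%R = (2 * complex.Re l)%:C) ?ltcR; first lra.
    by rewrite rmorphM /= complexRe ReE; field.
  pose x := map_mx (@complex.Re F) v; pose y := map_mx (@complex.Im F) v.
  have vE : v = toC x + 'i *: toC y by exact: complex_mx.
  have AvE : toC A *m v = toC (A *m x) + 'i *: toC (A *m y).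
    by rewrite {1}vE mulmxDr -scalemxAr !map_mxM.
  have xy0 : (x != 0) || (y != 0).
    apply: contraNT v0; rewrite negb_or !negbK => /andP[/eqP x0 /eqP y0].
    by rewrite vE x0 y0 !map_mx0 scaler0 addr0.
  have e1 := complex_form P (A *m x) (A *m y) x y.
  have e2 := complex_form P x y (A *m x) (A *m y).
  rewrite -vE -AvE in e1 e2; rewrite e1 e2.
  rewrite addrACA -scalerDr -!map_mxD /=.
  set s := (X in toC X + _); set k := (X in _ + 'i *: toC X).
  have ent (a b : 'M[F]_1) : (a + b) 0 0 = a 0 0 + b 0 0 by rewrite mxE.
  have entN (a : 'M[F]_1) : (- a) 0 0 = - a 0 0 by rewrite mxE.
  have -> : k = 0.
    apply/matrixP => i j; rewrite !ord1 /k !ent !entN [RHS]mxE.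
    rewrite (sym (A *m x)) (sym (A *m y)); ring.
  rewrite map_mx0 scaler0 addr0 [X in X < _]mxE ltcE /= eqxx /s !ent.
  rewrite (sym (A *m x)) (sym (A *m y)).
  move: (AP0 x) (AP0 y); case/orP: xy0 => /AP; lra.
move=> v v0; have /Ppos : toC v != 0 by rewrite map_mx_eq0.
by rewrite real_trmxC -!map_mxM mxE ltcR.
Qed.
End RealLyapunov.

(** * Storage functions *)

Section Storage.
Context {F : fieldType} (r : nat).
Implicit Types (f : nat -> nat -> F) (p a c : {poly F}) (y : nat -> F).

(* The coefficients of the quotient of [\sum f i j s^i t^j] by [s + t]. *)
Definition antidiag_quo f (i j : nat) : F :=
  \sum_(l < i.+1) (-1) ^+ l * f (i - l)%N (j.+1 + l)%N.

Lemma antidiag_quo0 f j : antidiag_quo f 0 j = f 0%N j.+1.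
Proof. by rewrite /antidiag_quo big_ord1 mul1r addn0. Qed.

Lemma antidiag_quoS f i j :
  antidiag_quo f i.+1 j = f i.+1 j.+1 - antidiag_quo f i j.+1.
Proof.
rewrite /antidiag_quo big_ord_recl mul1r addn0 subn0 -sumrN; congr (_ + _).
by apply: eq_bigr => l _; rewrite lift0 exprS mulN1r mulNr subSS addnS addSn.
Qed.

(** The second hypothesis says that every homogeneous part of [f(s, t)] vanishes at [t = -s], whence
    [f = (s + t) q]. Reading [s^i t^j] as [y i * y j] turns multiplication by [s] or [t] into a
    shift of one index. *)
Lemma antidiag_quo_bilinear f :
  (forall i j, (r < i)%N || (r < j)%N -> f i j = 0) ->
  (forall m, \sum_(i < m.+1) (-1) ^+ (m - i) * f i (m - i)%N = 0) ->
  forall y, \sum_(i < r) \sum_(j < r)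
    antidiag_quo f i j * (y i * y j.+1 + y i.+1 * y j) =
  \sum_(i < r.+1) \sum_(j < r.+1) f i j * (y i * y j).
Proof.
move=> f0 fm y; set q := antidiag_quo f.
(* The vanishing alternating sum of index [i + 1] closes the recursion at [j = 0]. *)
have qi0 i : q i 0%N = f i.+1 0%N.
  apply/eqP; rewrite -subr_eq0 -oppr_eq0 opprB -(fm i.+1) big_ord_recr /= subnn mul1r.
  rewrite addrC; apply/eqP; congr (_ + _); rewrite -sumrN (reindex_inj rev_ord_inj) /=.
  apply: eq_bigr => l _; rewrite subSS subKn; last by rewrite -ltnS.
  rewrite (_ : (i.+1 - l = (i - l).+1)%N); last by rewrite subSn // -ltnS.
  by rewrite exprS mulN1r mulNr add1n.
(* The quotient has degree below [r] in each variable; for the first one the recursion is run by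
   induction on [j]. *)
have q_out i j : (r <= i)%N -> q i j = 0.
  elim: j i => [|j IHj] i ri; first by rewrite qi0 f0 // ltnS ri.
  have := antidiag_quoS f i j; rewrite -/q IHj ?(leq_trans ri) // f0 ?ltnS ?ri //.
  by rewrite add0r => /eqP; rewrite eq_sym oppr_eq0 => /eqP.
have q_out' i j : (r <= j)%N -> q i j = 0.
  move=> rj; rewrite /q /antidiag_quo big1 // => l _.
  by rewrite f0 ?mulr0 // addSn ltnS (leq_trans rj) ?leq_addr ?orbT.
(* The coefficients of [t q] and of [s q]. *)
pose q1 i j : F := if j is j'.+1 then q i j' else 0.
pose q2 i j : F := if i is i'.+1 then q i' j else 0.
have fE i j : f i j = q1 i j + q2 i j.
  case: i j => [|i] [|j] /=.
  - by have := fm 0%N; rewrite big_ord1 mul1r addr0.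
  - by rewrite addr0 /q antidiag_quo0.
  - by rewrite add0r qi0.
  by rewrite /q antidiag_quoS subrK.
transitivity (\sum_(i < r.+1) \sum_(j < r.+1) q1 i j * (y i * y j) +
              \sum_(i < r.+1) \sum_(j < r.+1) q2 i j * (y i * y j)); last first.
  rewrite -big_split; apply: eq_bigr => i _; rewrite -big_split.
  by apply: eq_bigr => j _; rewrite fE mulrDl.
have -> : \sum_(i < r.+1) \sum_(j < r.+1) q1 i j * (y i * y j) =
    \sum_(i < r) \sum_(j < r) q i j * (y i * y j.+1).
  rewrite big_ord_recr /= [X in _ + X]big1 ?addr0 => [|j _]; last first.
    by case: j => -[|j] //= _; rewrite ?q_out ?mul0r.
  apply: eq_bigr => i _; rewrite big_ord_recl /= mul0r add0r.
  by apply: eq_bigr => j _.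
have -> : \sum_(i < r.+1) \sum_(j < r.+1) q2 i j * (y i * y j) =
    \sum_(i < r) \sum_(j < r) q i j * (y i.+1 * y j).
  rewrite big_ord_recl /= big1 ?add0r => [|j _]; last by rewrite mul0r.
  apply: eq_bigr => i _; rewrite big_ord_recr /= q_out' // mul0r addr0.
  by apply: eq_bigr => j _.
rewrite -big_split; apply: eq_bigr => i _; rewrite -big_split.
by apply: eq_bigr => j _; rewrite mulrDr.
Qed.

Lemma coef_comp_NX p i : (p \Po - 'X)`_i = (-1) ^+ i * p`_i.
Proof.
elim/poly_ind: p i => [|p c IHp] i; first by rewrite comp_poly0 coef0 mulr0.
rewrite comp_poly_MXaddC mulrN !coefD coefN !coefMX !coefC.
by case: i => [|i] /=; rewrite ?oppr0 ?mul1r // !addr0 IHp exprS mulN1r mulNr.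
Qed.

(** With [y k] in the role of the [k]-th derivative of [w], this is [p(D) w] for [p] of degree at
    most [r]. *)
Definition pairing p y : F := \sum_(i < r.+1) p`_i * y i.

(* Willems' storage function: since the supply and the dissipation agree at
   [(s, -s)], their difference is divisible by [s + t]. *)
Lemma storage_function a c (ds : seq {poly F}) :
  (size a <= r.+1)%N -> (size c <= r.+1)%N ->
  (forall d, d \in ds -> (size d <= r.+1)%N) ->
  a * (c \Po - 'X) + c * (a \Po - 'X) = \sum_(d <- ds) d * (d \Po - 'X) ->
  exists q : 'M[F]_r, forall y,
    \sum_(i < r) \sum_(j < r) q i j * (y i * y j.+1 + y i.+1 * y j) =
    2 * pairing a y * pairing c y - \sum_(d <- ds) pairing d y ^+ 2.
Proof.
move=> sa sc sd acE.
pose f i j := a`_i * c`_j + c`_i * a`_j - \sum_(d <- ds) d`_i * d`_j.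
exists (\matrix_(i, j) antidiag_quo f i j) => y.
transitivity (\sum_(i < r.+1) \sum_(j < r.+1) f i j * (y i * y j)).
  rewrite -antidiag_quo_bilinear.
  - by apply: eq_bigr => i _; apply: eq_bigr => j _; rewrite mxE.
  - move=> i j /orP[ri|rj]; rewrite /f.
      rewrite !(nth_default _ (leq_trans _ ri)) // !mul0r add0r big_seq big1 ?subr0 // => d /sd sdr.
      by rewrite nth_default ?mul0r // (leq_trans sdr).
    rewrite !(nth_default _ (leq_trans _ rj)) // !mulr0 add0r big_seq big1 ?subr0 // => d /sd sdr.
    by rewrite [d`_j]nth_default ?mulr0 // (leq_trans sdr).
  move=> m; have /(congr1 (fun p : {poly F} => p`_m)) := acE.
  rewrite coefD !coefM coef_sum -big_split => /eqP; rewrite -subr_eq0 => /eqP e; rewrite -[RHS]e.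
  transitivity (\sum_(i < m.+1) (a`_i * (c \Po - 'X)`_(m - i) + c`_i * (a \Po - 'X)`_(m - i)
      - \sum_(d <- ds) d`_i * (d \Po - 'X)`_(m - i))).
    apply: eq_bigr => i _; rewrite /f mulrBr mulr_sumr !coef_comp_NX; congr (_ - _).
      ring.
    by apply: eq_bigr => d _; rewrite coef_comp_NX; ring.
  rewrite sumrB exchange_big /=; congr (_ - _).
  by apply: eq_bigr => d _; rewrite coefM.
have pairM p q : pairing p y * pairing q y =
    \sum_(i < r.+1) \sum_(j < r.+1) (p`_i * q`_j) * (y i * y j).
  rewrite /pairing mulr_suml; apply: eq_bigr => i _; rewrite mulr_sumr.
  by apply: eq_bigr => j _; ring.
have -> : 2 * pairing a y * pairing c y = pairing a y * pairing c y + pairing c y * pairing a y by ring.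
have -> : \sum_(d <- ds) pairing d y ^+ 2 =
    \sum_(i < r.+1) \sum_(j < r.+1) (\sum_(d <- ds) d`_i * d`_j) * (y i * y j).
  under eq_bigr => d _ do rewrite expr2 pairM.
  rewrite exchange_big; apply: eq_bigr => i _.
  by rewrite exchange_big; apply: eq_bigr => j _; rewrite mulr_suml.
rewrite !pairM -big_split -sumrB; apply: eq_bigr => i _.
rewrite -big_split -sumrB; apply: eq_bigr => j _ /=.
by rewrite /f mulrBl mulrDl.
Qed.
End Storage.

(** * Krylov coordinates *)

Lemma horner_char_poly (F : fieldType) n (A : 'M[F]_n) x :
  (char_poly A).[x] = \det (x%:M - A).
Proof.
rewrite /char_poly -horner_evalE -det_map_mx; congr (\det _).
apply/matrixP => i j; rewrite !mxE /= horner_evalE hornerD hornerN hornerC.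
by rewrite hornerMn hornerX.
Qed.

(** One bordered matrix is factored as lower times upper and as upper times lower block triangular;
    the determinants are compared. *)
Lemma det_add_mul_row (F : comNzRingType) n (w : 'cV[F]_n) (v : 'rV[F]_n) :
  \det (1%:M + w *m v) = 1 + (v *m w) 0 0.
Proof.
have e1 : block_mx 1%:M (- v) w 1%:M =
    block_mx 1%:M 0 w 1%:M *m block_mx 1%:M (- v) 0 (1%:M + w *m v).
  by rewrite mulmx_block !mul0mx !mulmx0 !mul1mx !mulmx1 !addr0 mulmxN addrCA addNr addr0.
have e2 : block_mx 1%:M (- v) w 1%:M =
    block_mx (1%:M + v *m w) (- v) 0 1%:M *m block_mx 1%:M 0 w 1%:M.
  by rewrite mulmx_block !mul0mx !mulmx0 !mul1mx !mulmx1 !add0r mulNmx addrK.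
have := congr1 determinant e1; rewrite e2 !det_mulmx !det_lblock !det_ublock.
by rewrite !det1 !mul1r !mulr1 det_mx11 !mxE => ->.
Qed.

Lemma poly_eq0_forall (F : numFieldType) (p : {poly F}) : (forall x, p.[x] = 0) -> p = 0.
Proof.
move=> p0; apply/eqP/negPn/negP => pn0.
have := @max_poly_roots _ p [seq i%:R | i <- iota 0 (size p)] pn0.
rewrite size_map size_iota ltnn map_inj_uniq ?iota_uniq //; last first.
  by move=> i j /eqP; rewrite eqr_nat => /eqP.
move=> H; suff: false by []; apply: H => //.
by apply/allP => x _; apply/eqP.
Qed.

Section Krylov.
Context {F : numFieldType} {n : nat}.
Local Notation r := n.+1.
Variables (A : 'M[F]_r) (g : 'cV[F]_r).
Local Notation a := (char_poly A).

Definition krylov k : 'cV[F]_r := iter k (mulmx A) g.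

(* [krylov_basis m] is the coefficient of [s^(m-1)] in [adj (s - A) g]. *)
Definition krylov_basis m : 'cV[F]_r :=
  \sum_(j < r.+1 - m) a`_(m + j) *: krylov j.

Lemma krylov_basisS m : (m <= r)%N ->
  krylov_basis m = a`_m *: g + A *m krylov_basis m.+1.
Proof.
move=> mr; rewrite /krylov_basis subSn // big_ord_recl addn0; congr (_ + _).
rewrite subSS mulmx_sumr; apply: eq_bigr => j _.
by rewrite lift0 addnS addSn -scalemxAr.
Qed.

(** The sum is [a(A) g], zero by Cayley-Hamilton. *)
Lemma krylov_basis0 : krylov_basis 0 = 0.
Proof.
rewrite -(mul0mx _ g) -(Cayley_Hamilton A) /krylov_basis subn0 /horner_mx /horner_morph.
have kE j : krylov j = A ^+ j *m g.
  by elim: j => [|j IHj]; rewrite ?mul1mx // /krylov iterS -/(krylov j) IHj exprS mulmxA.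
rewrite horner_coef size_map_poly size_char_poly mulmx_suml.
apply: eq_bigr => j _; rewrite coef_map /= kE -mulmxE.
by rewrite add0n mul_scalar_mx -scalemxAl.
Qed.

Lemma krylov_basis_last : krylov_basis r = g.
Proof.
rewrite /krylov_basis subSnn big_ord1 addn0.
by have /eqP := char_poly_monic A; rewrite lead_coefE size_char_poly => ->; rewrite scale1r.
Qed.

Lemma krylov_basis_out : krylov_basis r.+1 = 0.
Proof. by rewrite /krylov_basis subnn big_ord0. Qed.

(** The state expressed through the flat output [w], with [y k] standing for its [k]-th
    derivative. *)
Definition krylov_comb (y : nat -> F) : 'cV[F]_r :=
  \sum_(k < r) y k *: krylov_basis k.+1.

(** Shifting [y] is differentiation, so this is the state equation [z' = A z + u g] with
    [u = a(D) w]. It sums the recursion [krylov_basisS], whose two end terms vanish. *)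
Lemma krylov_comb_shift (y : nat -> F) :
  A *m krylov_comb y + pairing r a y *: g = krylov_comb (fun k => y k.+1).
Proof.
have -> : krylov_comb (fun k => y k.+1) = \sum_(k < r.+1) y k *: krylov_basis k.
  by rewrite [RHS]big_ord_recl krylov_basis0 scaler0 add0r.
under [RHS]eq_bigr => k _ do rewrite (krylov_basisS (leq_ord k)) scalerDr scalerA.
rewrite big_split /= -scaler_suml addrC; congr (_ + _).
  rewrite [RHS]big_ord_recr /= krylov_basis_out mulmx0 scaler0 addr0 mulmx_sumr.
  by apply: eq_bigr => k _; rewrite scalemxAr.
by congr (_ *: _); apply: eq_bigr => k _; rewrite mulrC.
Qed.

Definition krylov_mx : 'M[F]_r := \matrix_(i, k) krylov_basis k.+1 i 0.

Lemma krylov_combE y : krylov_comb y = krylov_mx *m \col_k y k.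
Proof.
apply/matrixP => i j; rewrite ord1 summxE mxE; apply: eq_bigr => k _.
by rewrite !mxE mulrC.
Qed.

(** The left kernel of [krylov_mx] annihilates [g] and is invariant under [A], so it annihilates
    every Krylov vector and is zero by controllability. *)
Lemma krylov_mx_unit : \rank (\matrix_(i < r, j < r) krylov j i 0) = r ->
  krylov_mx \in unitmx.
Proof.
move=> rk; rewrite unitmxE unitfE; apply/negP => /det0P[w w0 wN].
have wN' (v : 'rV_r) : v *m krylov_mx = 0 -> forall k, (k <= r.+1)%N -> v *m krylov_basis k = 0.
  move=> vN [|k] kr; first by rewrite krylov_basis0 mulmx0.
  move: kr; rewrite ltnS leq_eqVlt => /orP[/eqP ->|kr].
    by rewrite krylov_basis_out mulmx0.
  apply/matrixP => i j; have /matrixP/(_ i (Ordinal kr)) := vN; rewrite !mxE => e; rewrite -[RHS]e.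
  by apply: eq_bigr => l _; rewrite mxE !ord1.
have inv (v : 'rV_r) : v *m krylov_mx = 0 -> v *m A *m krylov_mx = 0.
  move=> vN; apply/matrixP => i k; rewrite [LHS]mxE [RHS]mxE.
  have := krylov_basisS (m := k) (ltnW (ltn_ord k)).
  move=> /(congr1 (mulmx v)); rewrite mulmxDr -scalemxAr -{1}krylov_basis_last !wN' //.
    rewrite scaler0 add0r mulmxA => /esym/matrixP/(_ i 0); rewrite !mxE => e; rewrite -[RHS]e.
    by apply: eq_bigr => l _; congr (_ * _); rewrite mxE.
  by rewrite (leq_trans (ltnW (ltn_ord k))).
have wk j : w *m krylov j = 0.
  have vk (v : 'rV_r) : v *m krylov_mx = 0 -> v *m krylov j = 0.
    elim: j v => [|j IHj] v vN; first by rewrite /krylov /= -krylov_basis_last wN'.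
    by rewrite /krylov iterS mulmxA IHj // inv.
  exact: vk.
have : \det (\matrix_(i < r, j < r) krylov j i 0) != 0.
  by rewrite -unitfE -unitmxE -row_free_unit /row_free rk.
move=> /negP; apply; apply/det0P; exists w => //.
apply/matrixP => i j; have /matrixP/(_ i 0) := wk j; rewrite !mxE => e; rewrite -[RHS]e.
by apply: eq_bigr => l _; rewrite mxE.
Qed.

Variable h : 'cV[F]_r.

(** The numerator [h^T adj (s - A) g] of the transfer function [h^T (s - A)^-1 g]. *)
Definition num_poly : {poly F} := \poly_(k < r) (h^T *m krylov_basis k.+1) 0 0.

Lemma pairing_num y : pairing r num_poly y = (h^T *m krylov_comb y) 0 0.
Proof.
rewrite /pairing big_ord_recr /= coef_poly ltnn mul0r addr0 mulmx_sumr summxE.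
by apply: eq_bigr => k _; rewrite coef_poly ltn_ord -scalemxAr [RHS]mxE mulrC.
Qed.

Lemma horner_pairing (p : {poly F}) s : (size p <= r.+1)%N ->
  p.[s] = pairing r p (fun k => s ^+ k).
Proof. by move=> sp; rewrite (horner_coef_wide _ sp). Qed.

(** By the matrix determinant lemma this is the characteristic polynomial of [A - g h^T]. *)
Local Notation c := (a + num_poly).

Lemma size_num_poly : (size num_poly <= r)%N.
Proof. exact: size_poly. Qed.

(** Since [s^2 - A (A - g h^T) = (s - A) (s + A) + A g h^T] is a rank-one update of a matrix
    invertible at such [s], [det_add_mul_row] gives its determinant. The sign comes from
    [det (s + A) = (-1)^r a(-s)]. *)
Lemma num_poly_horner s : a.[s] != 0 -> a.[- s] != 0 ->
  a.[s] * c.[- s] + c.[s] * a.[- s] =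
  2 * ((-1) ^+ r * (char_poly (A *m (A - g *m h^T))).[s ^+ 2]).
Proof.
move=> as0 as'0; pose v t := krylov_comb (fun k => t ^+ k).
have vE t : (t%:M - A) *m v t = a.[t] *: g.
  rewrite mulmxBl mul_scalar_mx (horner_pairing _ (_ : (size a <= r.+1)%N)) ?size_char_poly //.
  apply/eqP; rewrite subr_eq addrC krylov_comb_shift /v /krylov_comb scaler_sumr; apply/eqP.
  by apply: eq_bigr => k _; rewrite scalerA exprS.
have bE t : num_poly.[t] = (h^T *m v t) 0 0.
  by rewrite horner_pairing ?pairing_num // (leq_trans size_num_poly).
pose M := s%:M - A; pose M' := s%:M + A.
have MM' : M *m M' = M' *m M.
  by rewrite !(mulmxBl, mulmxBr, mulmxDl, mulmxDr) !mul_scalar_mx !mul_mx_scalar addrAC.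
have M'E : M' = - ((- s)%:M - A) by rewrite opprB raddfN opprK addrC.
have detM : \det M = a.[s] by rewrite horner_char_poly.
have detM' : \det M' = (-1) ^+ r * a.[- s].
  by rewrite M'E -scaleN1r detZ horner_char_poly.
(* As [v(s) / a(s) = (s - A)^-1 g], partial fractions make [w] the solution of
   [(s - A) (s + A) w = A g]. *)
pose w := 2^-1 *: ((a.[s])^-1 *: v s + (a.[- s])^-1 *: v (- s)).
have Mv : M *m M' *m v s = a.[s] *: (M' *m g) by rewrite MM' -mulmxA vE scalemxAr.
have Mv' : M *m M' *m v (- s) = - (a.[- s] *: (M *m g)).
  by rewrite -mulmxA {1}M'E mulNmx vE mulmxN scalemxAr.
have Bw : M *m M' *m w = A *m g.
  rewrite /w -scalemxAr mulmxDr -!scalemxAr Mv Mv' scalerN !scalerA !mulVf //.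
  rewrite !scale1r -mulmxBl (_ : M' - M = 2 *: A) -?scalemxAl ?scalerA ?mulVf ?scale1r //.
    by rewrite pnatr_eq0.
  by rewrite /M /M' opprB addrC addrA subrK -mulr2n scaler_nat.
have -> : (char_poly (A *m (A - g *m h^T))).[s ^+ 2] =
    a.[s] * ((-1) ^+ r * a.[- s]) * (1 + (h^T *m w) 0 0).
  rewrite horner_char_poly -det_add_mul_row -detM -detM' -!det_mulmx; congr (\det _).
  rewrite [RHS]mulmxDr mulmx1 [(M *m M') *m (_ *m _)]mulmxA Bw mulmxBr opprB.
  have -> : M *m M' = (s ^+ 2)%:M - A *m A.
    rewrite mulmxBl !mulmxDr -scalar_mxM mul_scalar_mx mul_mx_scalar expr2.
    by rewrite opprD addrA addrK.
  by rewrite mulmxA addrA addrAC.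
have -> : (h^T *m w) 0 0 =
    2^-1 * (a.[s]^-1 * (h^T *m v s) 0 0 + a.[- s]^-1 * (h^T *m v (- s)) 0 0).
  by rewrite /w -scalemxAr mulmxDr -!scalemxAr; move: (h^T *m v s) (h^T *m v (- s)) => x x'; rewrite !mxE.
rewrite !hornerD !bE; move: (h^T *m v s) (h^T *m v (- s)) => x x'.
have e1 : (-1) ^+ r * (-1) ^+ r = 1 :> F by rewrite -exprD addnn -signr_odd odd_double.
transitivity ((-1) ^+ r * (-1) ^+ r * (a.[s] * (a.[- s] + x' 0 0) + (a.[s] + x 0 0) * a.[- s])).
  by rewrite e1 mul1r.
have two0 : 2 != 0 :> F by rewrite pnatr_eq0.
by field; rewrite as0 as'0.
Qed.

(** After multiplication by [a(s) a(-s)] the identity also holds at the points excluded from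
    [num_poly_horner]; these nonzero factors are then cancelled. *)
Lemma num_poly_identity :
  a * (c \Po - 'X) + c * (a \Po - 'X) =
  2 *: (((-1) ^+ r *: (char_poly (A *m (A - g *m h^T)) \Po - 'X)) \Po - 'X^2).
Proof.
have a0 : a != 0 by rewrite monic_neq0 ?char_poly_monic.
have a'0 : a \Po - 'X != 0 by rewrite comp_poly2_eq0 // size_polyN size_polyX.
apply/eqP; rewrite -subr_eq0 -(mulrI_eq0 _ (mulfI (mulf_neq0 a0 a'0))); apply/eqP.
apply: poly_eq0_forall => s.
have hN p : (p \Po - 'X).[s] = p.[- s] :> F by rewrite horner_comp hornerN hornerX.
have [as0|as0] := eqVneq a.[s] 0; first by rewrite !hornerM as0 !mul0r.
have [as'0|as'0] := eqVneq a.[- s] 0; first by rewrite !hornerM hN as'0 mulr0 mul0r.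
have e1 : (a * (c \Po - 'X) + c * (a \Po - 'X)).[s] =
    a.[s] * c.[- s] + c.[s] * a.[- s] by rewrite hornerD !hornerM !hN.
rewrite hornerM [X in _ * X]hornerD e1 hornerN hornerZ horner_comp hornerZ.
rewrite horner_comp !hornerN hornerX hornerXn opprK num_poly_horner //.
by rewrite subrr mulr0.
Qed.

End Krylov.

(** * Rank-one perturbations *)

Section RankOneStorage.
Context {F : rcfType}.

Lemma noroot_gt0 (q : {poly F}) : 0 < lead_coef q ->
  (forall x, 0 <= x -> ~~ root q x) -> forall x, 0 <= x -> 0 < q.[x].
Proof.
move=> lq q0 x x0; rewrite ltNge; apply/negP => qx.
have [m hm] := poly_pinfty_gt_lc lq; pose b := Num.max x m.
have xb : x <= b by rewrite le_max lexx.
have qb : lead_coef q <= q.[b] by apply: hm; rewrite le_max lexx orbT.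
have [|t /andP[xt _]] := @poly_ivt _ q x b xb.
  by rewrite qx (le_trans (ltW lq)).
by apply/negP/q0/(le_trans x0).
Qed.

(** The reflected polynomial has no positive root and a simple zero at the origin, so the monic
    quotient by ['X] has no root on the half line and is positive there. A root of [q] at the origin
    would make it a double root of [chi]. *)
Lemma reflected_factor (chi : {poly F}) r : chi \is monic -> size chi = r.+1 ->
  (forall l, l < 0 -> ~~ root chi l) -> mup 0 chi = 1%N ->
  exists q, [/\ (-1) ^+ r *: (chi \Po - 'X) = q * 'X, size q = r &
    forall x, 0 <= x -> 0 < q.[x]].
Proof.
move=> mchi schi nchi mu; set f := (-1) ^+ r *: _.
have sgn : (-1) ^+ r * (-1) ^+ r = 1 :> F.
  by rewrite -exprD addnn -signr_odd odd_double.
have chi0 : chi != 0 by rewrite monic_neq0.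
have fx x : f.[x] = (-1) ^+ r * chi.[- x].
  by rewrite hornerZ horner_comp hornerN hornerX.
have sN : size (- 'X : {poly F}) = 2 by rewrite size_polyN size_polyX.
have sf : size f = r.+1 by rewrite size_scale ?signr_eq0 // size_comp_poly2.
have rchi : root chi 0.
  by rewrite root_factor_theorem XsubC_dvd // mu.
have [|q fE sq] := @root_size _ f 0; first by rewrite rootE fx oppr0 (rootP rchi) mulr0.
rewrite subr0 sf /= in fE sq; exists q; split=> //.
have lq : lead_coef q = 1.
  rewrite -(lead_coefMX q) -fE lead_coefE sf coefZ coef_comp_NX mulrA sgn mul1r.
  by move/monicP: mchi; rewrite lead_coefE schi.
apply: noroot_gt0 => [|x]; first by rewrite lq.
rewrite le_eqVlt => /orP[/eqP <-|x0]; last first.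
  apply/negP => /rootP qx; have := nchi (- x); rewrite oppr_lt0 x0 => /(_ isT).
  have := fx x; rewrite fE hornerM qx mul0r => /esym/eqP.
  by rewrite mulf_eq0 signr_eq0 /= -rootE => ->.
apply/negP => /factor_theorem[q1 qE]; suff: (2 <= mup 0 chi)%N by rewrite mu.
rewrite mup_geq //.
have -> : chi = (-1) ^+ r *: (f \Po - 'X).
  rewrite /f comp_polyZ scalerA sgn scale1r -comp_polyA.
  by rewrite (_ : - 'X \Po - 'X = 'X) ?comp_polyXr // -[X in X \Po _]sub0r comp_polyB comp_poly0 comp_polyX sub0r opprK.
rewrite fE qE subr0 !comp_polyM comp_polyX dvdpZr ?signr_eq0 //.
by rewrite -mulrA mulrNN -expr2 dvdp_mulIr.
Qed.

Lemma reflected_sos (chi : {poly F}) r : min_attained F ->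
  chi \is monic -> size chi = r.+1 ->
  (forall l, l < 0 -> ~~ root chi l) -> mup 0 chi = 1%N ->
  exists (eps : F) (es : seq {poly F}), [/\ 0 < eps,
    forall e, e \in es -> (size e <= r.+1)%N &
    2 *: (((-1) ^+ r *: (chi \Po - 'X)) \Po - 'X^2) =
    \sum_(d <- es ++ [seq eps *: 'X^(k.+1) | k <- iota 0 r]) d * (d \Po - 'X)].
Proof.
move=> Fmin mchi schi nchi mu.
have [q [-> sq q0]] := reflected_factor mchi schi nchi mu.
have [eps e0 qe] := pos_sub_geom_ge0 Fmin q0 sq.
have [es esE ses] := nonneg_sos Fmin qe.
(* At [y = - 'X^2], [2 y] is the product of [t 'X] with its reflection, and [2 eps y^(k+1)] is that
   of [s 'X^(k+1)]; hence [s] is the witness returned. *)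
pose t : F := Num.sqrt 2; pose s := Num.sqrt (2 * eps).
have tt : t%:P * t%:P = 2%:P :> {poly F} by rewrite -polyCM -expr2 sqr_sqrtr.
have ss : s%:P * s%:P = (2 * eps)%:P by rewrite -polyCM -expr2 sqr_sqrtr // mulr_ge0 // ltW.
exists s, [seq t%:P * 'X * e | e <- es]; split=> [|d /mapP[e /ses se ->]|].
- by rewrite sqrtr_gt0 mulr_gt0.
- rewrite -mulrA mul_polyC (leq_trans (size_scale_leq _ _)) // mulrC.
  have [->|en0] := eqVneq e 0; first by rewrite mul0r size_poly0.
  rewrite size_mulX // ltnS (leq_trans se) // (leq_trans (size_polyD _ _)) //.
  rewrite geq_max sq leqnn size_polyN (leq_trans (size_scale_leq _ _)) //.
  by rewrite (leq_trans (size_sum _ _ _)) //; apply/bigmax_leqP => i _; rewrite size_polyXn.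
rewrite big_cat !big_map /=.
have -> : \sum_(e <- es) t%:P * 'X * e * ((t%:P * 'X * e) \Po - 'X) =
    2%:P * (- 'X^2) * \sum_(e <- es) e * (e \Po - 'X).
  rewrite mulr_sumr; apply: eq_bigr => e _; rewrite !comp_polyM comp_polyC comp_polyX -tt; ring.
have -> : \sum_(k <- iota 0 r) s *: 'X^(k.+1) * ((s *: 'X^(k.+1)) \Po - 'X) =
    2%:P * (- 'X^2) * (eps%:P * \sum_(k < r) (- 'X^2) ^+ k).
  rewrite -(big_mkord xpredT (fun k => (- 'X^2) ^+ k)) /index_iota subn0 !mulr_sumr.
  apply: eq_bigr => k _; rewrite comp_polyZ -!mul_polyC rmorphXn /= comp_polyX.
  rewrite mulrACA ss polyCM -exprMn mulrN -expr2 exprS; ring.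
rewrite -mulrDr -esE -mul_polyC comp_polyM comp_polyX -mulrA [_ * - _]mulrC; congr (_ * (_ * _)).
rewrite comp_polyB comp_polyZ mul_polyC raddf_sum /=.
by under eq_bigr => k _ do rewrite rmorphXn /= comp_polyX; rewrite subrK.
Qed.

Lemma pairing_Xn r (s : F) k (y : nat -> F) : (k < r)%N ->
  pairing r (s *: 'X^(k.+1)) y = s * y k.+1.
Proof.
move=> kr; rewrite /pairing (bigD1 (Ordinal (_ : k.+1 < r.+1)%N)) //=.
rewrite coefZ coefXn eqxx mulr1 big1 ?addr0 // => i.
by rewrite -val_eqE /= coefZ coefXn => /negbTE ->; rewrite mulr0 mul0r.
Qed.

Definition sqnorm n (v : 'cV[F]_n) : F := \sum_i v i 0 ^+ 2.

(** A dissipation inequality for arbitrary state and input. Its supply [2 u (u + h^T z)] vanishes at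
    [u = 0] and at [u = - h^T z], the inputs that realize the two modes. *)
Lemma rank_one_storage n (A : 'M[F]_n.+1) (g h : 'cV[F]_n.+1) :
  min_attained F ->
  \rank (\matrix_(i < n.+1, j < n.+1) krylov A g j i 0) = n.+1 ->
  (forall l, l < 0 -> ~~ root (char_poly (A *m (A - g *m h^T))) l) ->
  mup 0 (char_poly (A *m (A - g *m h^T))) = 1%N ->
  exists (P N : 'M[F]_n.+1) (k : F), [/\ P^T = P, N \in unitmx, 0 < k &
    forall (z : 'cV_n.+1) u,
      2 * (z^T *m P *m (A *m z + u *: g)) 0 0 <=
      2 * u * (u + (h^T *m z) 0 0) - k * sqnorm (invmx N *m (A *m z + u *: g))].
Proof.
move=> Fmin rk nroot mu; set r := n.+1.
have [eps [es [eps0 ses sosE]]] :=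
  reflected_sos Fmin (char_poly_monic _) (size_char_poly _) nroot mu.
pose a : {poly F} := char_poly A; pose b := num_poly A g h.
have sa : size a = r.+1 by rewrite size_char_poly.
have sb : (size b <= r.+1)%N by rewrite (leq_trans (size_num_poly A g h)).
have sc : (size (a + b)%R <= r.+1)%N.
  by rewrite (leq_trans (size_polyD _ _)) // geq_max sa leqnn.
have [||q qE] := @storage_function F r a (a + b) _ _ sc _ (etrans (num_poly_identity A g h) sosE).
- by rewrite sa.
- move=> d; rewrite mem_cat => /orP[/ses //|/mapP[k]].
  rewrite mem_iota add0n => /andP[_ kr] ->.
  by rewrite (leq_trans (size_scale_leq _ _)) // size_polyXn.
pose N := krylov_mx A g; have Nu : N \in unitmx by exact: krylov_mx_unit.
(* The symmetrized quotient is the form in Krylov coordinates; conjugation by [invmx N] expresses it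
   in [z]. *)
pose P0 : 'M[F]_r := 2^-1 *: (q + q^T).
exists ((invmx N)^T *m P0 *m invmx N), N, (eps ^+ 2); split=> //.
- by rewrite !trmx_mul trmxK mulmxA; congr (_ *m _ *m _); rewrite /P0 linearZ /= linearD /= trmxK addrC.
- by rewrite exprn_gt0.
move=> z u; pose v := invmx N *m z.
(* The first [r] entries are the Krylov coordinates of [z]; entry [r] is fixed by [a(D) w = u], [a]
   being monic. *)
pose y k : F := if (k < r)%N then v (inord k) 0 else u - \sum_(i < r) a`_i * v i 0.
have yv (i : 'I_r) : y i = v i 0 by rewrite /y ltn_ord inord_val.
have zE : krylov_comb A g y = z.
  rewrite krylov_combE -/N (_ : \col_k y k = v) ?mulKVmx //.
  by apply/matrixP => i j; rewrite mxE ord1 yv.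
have uE : pairing r a y = u.
  rewrite /pairing big_ord_recr /= {2}/y ltnn (_ : a`_r = 1); last first.
    by have /monicP := char_poly_monic A; rewrite lead_coefE sa.
  rewrite mul1r; under eq_bigr => i _ do rewrite yv.
  by rewrite addrC subrK.
have yE : invmx N *m (A *m z + u *: g) = \col_k y k.+1.
  by rewrite -{1}zE -{1}uE krylov_comb_shift krylov_combE mulKmx.
have := qE y.
rewrite uE /pairing; under [X in _ = 2 * u * X - _]eq_bigr => i _ do rewrite coefD mulrDl.
rewrite big_split /= -/(pairing r a y) -/(pairing r b y) uE pairing_num zE => {}qE.
have -> : 2 * (z^T *m ((invmx N)^T *m P0 *m invmx N) *m (A *m z + u *: g)) 0 0 =
   2 * u * (u + (h^T *m z) 0 0) -
   \sum_(d <- es ++ [seq eps *: 'X^(k.+1) | k <- iota 0 r]) pairing r d y ^+ 2.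
  rewrite -qE !mulmxA -trmx_mul -/v -[_ *m invmx N *m _]mulmxA yE.
  clearbody v.
  have -> : \sum_i \sum_j q i j * (y i * y j.+1 + y i.+1 * y j) =
      \sum_i \sum_j (q i j + q j i) * (y i * y j.+1).
    transitivity (\sum_i \sum_j q i j * (y i * y j.+1) +
                  \sum_i \sum_j q i j * (y i.+1 * y j)).
      rewrite -big_split; apply: eq_bigr => i _; rewrite -big_split.
      by apply: eq_bigr => j _; rewrite mulrDr.
    rewrite [X in _ + X]exchange_big -big_split; apply: eq_bigr => i _.
    by rewrite -big_split; apply: eq_bigr => j _ /=; ring.
  rewrite mxE mulr_sumr [RHS]exchange_big /=; apply: eq_bigr => j _.
  rewrite !mxE mulr_suml mulr_sumr; apply: eq_bigr => i _; rewrite !mxE yv.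
  by field.
(* The squares from [es] are dropped; the monomials give [eps ^+ 2] times the squared norm of the
   shifted coordinates. *)
rewrite lerD2l lerN2 yE big_cat big_map.
rewrite /sqnorm mulr_sumr -[X in X <= _]add0r lerD //.
  by rewrite sumr_ge0 // => d _; rewrite sqr_ge0.
rewrite -[iota 0 r]/(index_iota 0 r) big_mkord ler_sum // => i _.
by rewrite pairing_Xn // exprMn mxE.
Qed.

End RankOneStorage.

(** * A common quadratic Lyapunov function *)

Section CommonLyapunov.
Context {F : rcfType}.

(** Lagrange's identity: twice the difference of the two sides is the sum of the squares of
    [a i * b j - a j * b i]. *)
Lemma cauchy_schwarz_sum m (a b : 'I_m -> F) :
  (\sum_i a i * b i) ^+ 2 <= (\sum_i a i ^+ 2) * (\sum_i b i ^+ 2).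
Proof.
have : 0 <= \sum_i \sum_j (a i * b j - a j * b i) ^+ 2.
  by apply: sumr_ge0 => i _; apply: sumr_ge0 => j _; rewrite sqr_ge0.
have -> : \sum_i \sum_j (a i * b j - a j * b i) ^+ 2 =
    \sum_i \sum_j a i ^+ 2 * b j ^+ 2 + \sum_i \sum_j a j ^+ 2 * b i ^+ 2 -
    2 * \sum_i \sum_j (a i * b i) * (a j * b j).
  rewrite mulr_sumr -big_split -sumrB; apply: eq_bigr => i _.
  rewrite mulr_sumr -big_split -sumrB; apply: eq_bigr => j _ /=; ring.
rewrite [X in _ + X - _]exchange_big /=.
have prodE (u v : 'I_m -> F) : \sum_i \sum_j u i * v j = (\sum_i u i) * (\sum_j v j).
  by rewrite mulr_suml; apply: eq_bigr => i _; rewrite mulr_sumr.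
rewrite (prodE (fun i => a i ^+ 2) (fun j => b j ^+ 2)).
rewrite (prodE (fun i => a i * b i) (fun i => a i * b i)); lra.
Qed.

Lemma sqnorm_ge0 n (v : 'cV[F]_n) : 0 <= sqnorm v.
Proof. by apply: sumr_ge0 => i _; rewrite sqr_ge0. Qed.

Lemma sqnorm_eq0 n (v : 'cV[F]_n) : (sqnorm v == 0) = (v == 0).
Proof.
rewrite psumr_eq0 => [|i _]; last exact: sqr_ge0.
apply/allP/eqP => [h|-> i _]; last by rewrite /= mxE expr0n /= eqxx.
apply/matrixP => i j; rewrite ord1 mxE; apply/eqP.
by have := h i (mem_index_enum i); rewrite /= sqrf_eq0.
Qed.

Lemma sqnorm_mulmx m n (M : 'M[F]_(m, n)) :
  exists2 C, 0 < C & forall v : 'cV_n, sqnorm (M *m v) <= C * sqnorm v.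
Proof.
pose C := 1 + \sum_i \sum_j M i j ^+ 2.
have C0 : 0 <= \sum_i \sum_j M i j ^+ 2.
  by apply: sumr_ge0 => i _; apply: sumr_ge0 => j _; rewrite sqr_ge0.
exists C => [|v]; first by rewrite ltr_pwDl.
apply: (@le_trans _ _ ((\sum_i \sum_j M i j ^+ 2) * sqnorm v)); last first.
  by rewrite ler_wpM2r ?sqnorm_ge0 // lerDr.
rewrite mulr_suml; apply: ler_sum => i _; rewrite mxE.
exact: cauchy_schwarz_sum.
Qed.

Lemma sqnorm_unitmx n (M : 'M[F]_n) : M \in unitmx ->
  exists2 C, 0 < C & forall v : 'cV_n, sqnorm v <= C * sqnorm (M *m v).
Proof.
move=> Mu; have [C C0 hC] := sqnorm_mulmx (invmx M).
by exists C => // v; rewrite -{1}[v](mulKmx Mu).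
Qed.

Lemma dot_le n (x y : 'cV[F]_n) : `|2 * (x^T *m y) 0 0| <= sqnorm x + sqnorm y.
Proof.
rewrite mxE mulr_sumr /sqnorm -big_split (le_trans (ler_norm_sum _ _ _)) //.
apply: ler_sum => i _; rewrite mxE /= ler_norml.
have := sqr_ge0 (x i 0 + y i 0); have := sqr_ge0 (x i 0 - y i 0).
by rewrite sqrrB sqrrD => h1 h2; apply/andP; split; lra.
Qed.

(** The inertia argument is applied to [P - d%:M] rather than to [P], so that positivity comes with
    the explicit lower bound [d]. *)
Lemma common_lyapunov n (A : 'M[F]_n.+1) (g h : 'cV[F]_n.+1) :
  min_attained F -> A \in unitmx ->
  (forall l, eigenvalue (map_mx (real_complex F) A) l -> complex.Re l < 0) ->
  \rank (\matrix_(i < n.+1, j < n.+1) krylov A g j i 0) = n.+1 ->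
  (forall l, l < 0 -> ~~ root (char_poly (A *m (A - g *m h^T))) l) ->
  mup 0 (char_poly (A *m (A - g *m h^T))) = 1%N ->
  exists (P : 'M[F]_n.+1) (k d : F), [/\ P^T = P, 0 < k, 0 < d,
    forall z : 'cV_n.+1, d * sqnorm z <= (z^T *m P *m z) 0 0 &
    forall B, B = A \/ B = A - g *m h^T -> forall z : 'cV_n.+1,
      2 * (z^T *m P *m (B *m z)) 0 0 <= - k * sqnorm (B *m z)].
Proof.
move=> Fmin Au Ah rk nroot mu.
have [P [N [k0 [Ps Nu k0_gt0 diss]]]] := rank_one_storage Fmin rk nroot mu.
have Niu : invmx N \in unitmx by rewrite unitmx_inv.
have [C C0 hC] := sqnorm_unitmx Niu; pose k := k0 / C.
have k_gt0 : 0 < k by rewrite divr_gt0.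
have lyap B : B = A \/ B = A - g *m h^T -> forall z : 'cV_n.+1,
    2 * (z^T *m P *m (B *m z)) 0 0 <= - k * sqnorm (B *m z).
  move=> BA z; have [u [uE BzE]] : exists u,
      u * (u + (h^T *m z) 0 0) = 0 /\ B *m z = A *m z + u *: g.
    case: BA => ->; first by exists 0; rewrite mul0r scale0r addr0.
    exists (- (h^T *m z) 0 0); rewrite addNr mulr0; split=> //.
    rewrite mulmxBl scaleNr; congr (_ - _); rewrite -mulmxA.
    by apply/matrixP => i j; rewrite ord1 mxE big_ord1 [RHS]mxE mulrC.
  have := diss z u; rewrite -BzE -mulrA uE mulr0 sub0r => /le_trans; apply.
  rewrite mulNr lerN2 /k -mulrA ler_wpM2l ?(ltW k0_gt0) // ler_pdivrMl //.
have [D D0 hD] := sqnorm_unitmx Au.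
(* Small enough for the term [2 d v^T A v] to cost at most half of the dissipation [k |A v|^2],
   given [|v|^2 <= D |A v|^2]. *)
pose d := k / (2 * (1 + D)).
have d_gt0 : 0 < d by rewrite divr_gt0 // mulr_gt0 // addr_gt0.
exists P, k, d; split=> // z.
have [->|z0] := eqVneq z 0.
  by rewrite mulmx0 mxE (eqP (_ : sqnorm 0 == 0)) ?mulr0 // sqnorm_eq0.
have split_form (x y : 'cV[F]_n.+1) :
    (x^T *m (P - d%:M) *m y) 0 0 = (x^T *m P *m y) 0 0 - d * (x^T *m y) 0 0.
  by rewrite mulmxBr mulmxBl mul_mx_scalar -scalemxAl; move: (_ *m y) (_ *m y) => a b; rewrite !mxE.
have := @hurwitz_real_lyap_pos F _ A (P - d%:M) _ Ah _ z z0.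
rewrite split_form subr_gt0 => H.
rewrite (_ : sqnorm z = (z^T *m z) 0 0); last first.
  by rewrite mxE; apply: eq_bigr => i _; rewrite mxE.
apply/ltW/H; first by rewrite linearB /= Ps tr_scalar_mx.
move=> v v0; rewrite split_form.
have Av0 : 0 < sqnorm (A *m v).
  rewrite lt_def sqnorm_ge0 andbT sqnorm_eq0; apply: contra v0 => /eqP Av.
  by rewrite -[v](mulKmx Au) Av mulmx0.
have := lyap A (or_introl erefl) v.
have := dot_le v (A *m v); rewrite ler_norml => /andP[h1 _].
have h2 := hD v.
have h3 : d * (sqnorm v + sqnorm (A *m v)) <= k / 2 * sqnorm (A *m v).
  apply: (@le_trans _ _ (d * ((1 + D) * sqnorm (A *m v)))).
    by rewrite ler_wpM2l ?(ltW d_gt0) //; lra.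
  by rewrite mulrA ler_wpM2r ?sqnorm_ge0 // /d invfM mulrA mulfVK // gt_eqF // addr_gt0.
have h4 : d * (- (sqnorm v + sqnorm (A *m v))) <= d * (2 * (v^T *m (A *m v)) 0 0).
  by rewrite ler_wpM2l ?(ltW d_gt0).
have h5 : 0 < k * sqnorm (A *m v) by rewrite mulr_gt0.
move: h3 h4 h5; move: (sqnorm v) (sqnorm (A *m v)) ((v^T *m (A *m v)) 0 0).
move: ((v^T *m P *m (A *m v)) 0 0) => x y s t; lra.
Qed.
End CommonLyapunov.

(** * Descriptor pencils *)

Lemma Chorner_complex (p : {poly R}) (z : R[i]) :
  (map_poly (real_complex R) p).[z] =
  Complex (Chorner p (complex.Re z, complex.Im z)).1
          (Chorner p (complex.Re z, complex.Im z)).2.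
Proof.
rewrite map_polyE horner_Poly /Chorner; case: z => a b /=.
elim: (polyseq p) => [|c s IHs] //=; rewrite IHs.
set w := foldr _ _ _; rewrite /Cmul /=.
by apply/eqP; rewrite eq_complex /= addr0 !eqxx.
Qed.

Lemma pencil_poly_complex n (E A : 'M[R]_n) (z : R[i]) :
  (map_poly (real_complex R) (pencil_poly E A)).[z] =
  \det (z *: map_mx (real_complex R) E - map_mx (real_complex R) A).
Proof.
rewrite /pencil_poly -det_map_mx /= -horner_evalE -det_map_mx; congr (\det _).
apply/matrixP => i j; rewrite !mxE /= rmorphB /= rmorphM /= map_polyX !map_polyC /=.
by rewrite horner_evalE !hornerE.
Qed.

(** A left eigenvector [v] for [l] yields [w = v Y^T A^-1] with [w E = l w A], so [l^-1] is a root
    of the pencil; [l] and [l^-1] have real parts of the same sign. *)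
Lemma stable_Etilde_hurwitz n r (E A : 'M[R]_n) (X Y : 'M[R]_(n, r)) :
  A \in unitmx -> E = X *m Y^T -> desc_stable E A -> Etilde A X Y \in unitmx ->
  forall l, eigenvalue (map_mx (real_complex R) (Etilde A X Y)) l -> complex.Re l < 0.
Proof.
move=> Au EE st Eu l /eigenvalueP[v vE v0].
have l0 : l != 0.
  apply: contraNneq v0 => l0; move: vE; rewrite l0 scale0r => vE.
  have Eu' : map_mx (real_complex R) (Etilde A X Y) \in unitmx by rewrite map_unitmx.
  by rewrite -[v](mulmxK Eu') vE mul0mx.
pose tC m p := @map_mx _ _ (real_complex R) m p.
pose w := v *m tC _ _ Y^T *m tC _ _ (invmx A).
have wX : w *m tC _ _ X = l *: v by rewrite -vE /w /tC /Etilde !map_mxM /= !mulmxA.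
have wE : w *m tC _ _ E = l *: (w *m tC _ _ A).
  rewrite EE /tC map_mxM /= mulmxA wX /w -mulmxA -map_mxM /= mulVmx // map_mx1 mulmx1.
  by rewrite -scalemxAl.
have w0 : w != 0.
  apply: contraNneq v0 => w0; move: wX; rewrite w0 mul0mx => /esym/eqP.
  by rewrite scaler_eq0 (negbTE l0).
have root0 : (map_poly (real_complex R) (pencil_poly E A)).[l^-1] = 0.
  rewrite pencil_poly_complex; apply/eqP/det0P; exists w => //.
  by rewrite mulmxBr -scalemxAr wE scalerA mulVf // scale1r subrr.
rewrite Chorner_complex in root0.
have c0 : Chorner (pencil_poly E A) (complex.Re l^-1, complex.Im l^-1) = (0, 0).
  move/eqP: root0; rewrite eq_complex /= => /andP[/eqP e1 /eqP e2].
  by rewrite [LHS]surjective_pairing e1 e2.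
have /RltP := st _ _ c0; rewrite !ltNge; apply: contra.
by case: (l) => a b /= a0; rewrite divr_ge0 // addr_ge0 // sqr_ge0.
Qed.

Lemma colspace_eq_rank m n p (M : 'M[R]_(m, n)) (N : 'M[R]_(m, p)) :
  colspace_eq M N -> \rank M = \rank N.
Proof. by move=> /eqmxP e; rewrite -mxrank_tr e mxrank_tr. Qed.

(** [(A^-1 E)^2 = A^-1 X T Y^T], with [T] the matrix [Etilde A X Y], has the rank [r] of [A^-1 E],
    so [T] has rank at least [r]. *)
Lemma index1_Etilde_unit n r (E A : 'M[R]_n) (X Y : 'M[R]_(n, r)) :
  A \in unitmx -> full_rank_decomp E X Y -> desc_index E A 1 ->
  Etilde A X Y \in unitmx.
Proof.
move=> Au [rX [rY EE]] [/colspace_eq_rank + _]; rewrite /mxpow /= !mulmx1 => e.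
rewrite -row_free_unit -row_leq_rank -{1}rX.
have <- : \rank (invmx A *m E) = \rank X.
  rewrite -mxrank_tr trmx_mul mxrankMfree ?row_free_unit ?unitmx_tr ?unitmx_inv //.
  rewrite mxrank_tr EE mxrankMfree // /row_free mxrank_tr rY //.
rewrite -e EE (_ : invmx A *m (X *m Y^T) *m (invmx A *m (X *m Y^T)) =
    invmx A *m X *m Etilde A X Y *m Y^T); last by rewrite /Etilde !mulmxA.
by rewrite (leq_trans (mxrankM_maxl _ _)) // mxrankM_maxr.
Qed.

(** In [(A^-1 E)^(k+1) = A^-1 X T^k Y^T] the outer factors have full rank, so index two gives [T]
    and [T^2] equal rank, hence equal row space. The matrix [D] inverts [T] on the image of [T]. *)
Lemma index2_Etilde_drazin n r (E A : 'M[R]_n) (X Y : 'M[R]_(n, r)) :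
  A \in unitmx -> full_rank_decomp E X Y -> desc_index E A 2 ->
  exists D, Etilde A X Y = D *m (Etilde A X Y *m Etilde A X Y).
Proof.
move=> Au [rX [rY EE]] [/colspace_eq_rank + _]; rewrite /mxpow /= !mulmx1 => e.
set T := Etilde A X Y.
have rk (M : 'M_r) : \rank (invmx A *m X *m M *m Y^T) = \rank M.
  rewrite mxrankMfree /row_free ?mxrank_tr ?rY // -mxrank_tr trmx_mul.
  rewrite mxrankMfree ?mxrank_tr // /row_free trmx_mul.
  by rewrite mxrankMfree ?mxrank_tr ?rX // row_free_unit unitmx_tr unitmx_inv.
have : \rank (T *m T) = \rank T.
  have -> : \rank T = \rank (invmx A *m E *m (invmx A *m E)).
    by rewrite -rk EE /T /Etilde !mulmxA.
  by rewrite -e -rk EE /T /Etilde !mulmxA.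
move=> rkT; have : (T <= T *m T)%MS by rewrite -(geq_leqif (mxrank_leqif_sup (submxMl T T))) rkT.
by move=> /submxP[D DE]; exists D.
Qed.

(** * Real analysis *)

Section RealAnalysis.
Local Open Scope R_scope.

(** The interval is split at each exceptional point inside it; without exceptions the mean value
    theorem applies. *)
Lemma nonincreasing_finite_exceptions (f : R -> R) (l : list R) (a b : R) : a <= b ->
  (forall t, a <= t <= b -> continuity_pt f t) ->
  (forall t, a < t < b -> ~ List.In t l -> exists2 d, derivable_pt_lim f t d & d <= 0) ->
  f b <= f a.
Proof.
elim: l a b => [|c l IHl] a b ab fc fd.
  case: (Req_EM_T a b) => [->|nab]; first exact: Rle_refl.
  have {nab}ab : a < b by Lra.lra.
  have pr t : a < t < b -> derivable_pt f t.
    move=> ht; apply: constructive_indefinite_description.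
    by have [d fd' _] := fd t ht (fun h => h); exists d.
  have [|t [ht]] := MVT f id a b pr (fun t _ => derivable_pt_id t) ab fc.
    by move=> t _; exact/derivable_continuous_pt/derivable_pt_id.
  have [d fd' d0] := fd t ht (fun h => h).
  rewrite derive_pt_id (derive_pt_eq_0 _ _ _ _ fd') /id => e.
  suff : f b - f a <= 0 by Lra.lra.
  by rewrite -[f b - f a]Rmult_1_r -e; Lra.nra.
have [[ac cb]|nc] : (a < c < b) \/ ~ (a < c < b) by Lra.lra.
  apply: (Rle_trans _ (f c)).
    apply: IHl; first by Lra.lra.
      by move=> t ht; apply: fc; Lra.lra.
    by move=> t ht nt; apply: fd => [|[]]; [Lra.lra | Lra.lra |].
  apply: IHl; first by Lra.lra.
    by move=> t ht; apply: fc; Lra.lra.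
  by move=> t ht nt; apply: fd => [|[]]; [Lra.lra | Lra.lra |].
apply: IHl => // t ht nt; apply: fd => // -[ct|//].
by apply: nc; rewrite ct.
Qed.

Lemma list_gap_right (l : list R) (t : R) :
  exists2 d, 0 < d & forall s, t < s < t + d -> ~ List.In s l.
Proof.
elim: l => [|c l [d d0 hd]]; first by exists 1; [Lra.lra | move=> s _ []].
case: (Rle_lt_dec c t) => [ct|tc].
  by exists d => // s hs [cs|]; [Lra.lra | exact: hd].
exists (Rmin d (c - t)); first by apply: Rmin_pos; Lra.lra.
move=> s hs; have := Rmin_l d (c - t); have := Rmin_r d (c - t) => h1 h2.
by case=> [cs|]; [Lra.lra | apply: hd; Lra.lra].
Qed.

(** Viewed as a real function through [INR], [sigma] has zero derivative on the interval, so it is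
    monotone in both directions. *)
Lemma locally_const_interval (sigma : R -> nat) (a b : R) :
  (forall t, a < t < b -> locally_const sigma t) ->
  forall s t, a < s < b -> a < t < b -> sigma s = sigma t.
Proof.
move=> lc; suff H s t : a < s -> s <= t -> t < b -> sigma s = sigma t.
  move=> s t hs ht; case: (Rle_lt_dec s t) => st; first by apply: H; Lra.lra.
  by symmetry; apply: H; Lra.lra.
move=> sa st tb; pose f u := INR (sigma u).
have d0 u : s <= u <= t -> derivable_pt_lim f u 0.
  move=> hu; have [|d [d0 hd]] := lc u; first by Lra.lra.
  apply: (@derivable_pt_lim_locally_ext (fun=> f u) f u (u - d) (u + d)); first by Lra.lra.
    by move=> w hw; rewrite /f hd //; apply: Rabs_def1; Lra.lra.
  exact: derivable_pt_lim_const.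
have dN u : s <= u <= t -> derivable_pt_lim (fun x => - f x) u 0.
  by move=> /d0 h; rewrite -[0]Ropp_0; apply: derivable_pt_lim_opp.
apply: INR_eq; apply: Rle_antisym.
  suff : - f t <= - f s by rewrite /f; Lra.lra.
  apply: (@nonincreasing_finite_exceptions (fun x => - f x) nil) => // u hu.
    by apply: derivable_continuous_pt; exists 0; apply: dN.
  by move=> _; exists 0; [apply: dN; Lra.lra | exact: Rle_refl].
apply: (@nonincreasing_finite_exceptions f nil) => // u hu.
  by apply: derivable_continuous_pt; exists 0; apply: d0.
by move=> _; exists 0; [apply: d0; Lra.lra | exact: Rle_refl].
Qed.

Lemma right_mode_exists (sigma : R -> nat) (t : R) :
  piecewise_constant sigma -> exists j, right_mode sigma t j.
Proof.
move=> pc; have [l hl] := pc t (t + 1).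
have [d d0 hd] := list_gap_right l t.
pose e := Rmin d 1.
have e0 : 0 < e by apply: Rmin_pos; Lra.lra.
have ed : e <= d by exact: Rmin_l.
have e1 : e <= 1 by exact: Rmin_r.
exists (sigma (t + e / 2)), e; split=> // s ts se.
apply: (@locally_const_interval _ t (t + e)); [|Lra.lra|Lra.lra].
by move=> u hu; apply: hl; [Lra.lra | Lra.lra | apply: hd; Lra.lra].
Qed.

Lemma right_mode_locally_const (sigma : R -> nat) t j : right_mode sigma t j ->
  exists2 d, 0 < d & forall s, t < s < t + d -> locally_const sigma s /\ sigma s = j.
Proof.
move=> [d [d0 hd]]; exists d => // s hs; split; last by apply: hd; Lra.lra.
exists (Rmin (s - t) (t + d - s)); split; first by apply: Rmin_pos; Lra.lra.
move=> u hu; have := Rmin_l (s - t) (t + d - s); have := Rmin_r (s - t) (t + d - s).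
move: hu => /Rabs_def2 [? ?] ? ?.
by rewrite !hd //; Lra.lra.
Qed.

Lemma right_mode_unique (sigma : R -> nat) t i j :
  right_mode sigma t i -> right_mode sigma t j -> i = j.
Proof.
move=> [d [d0 hd]] [e [e0 he]]; pose s := t + Rmin d e / 2.
have m0 : 0 < Rmin d e by exact: Rmin_pos.
have := Rmin_l d e; have := Rmin_r d e => h1 h2.
by rewrite -(hd s) ?(he s) // /s; Lra.lra.
Qed.

Lemma locally_const_right_mode (sigma : R -> nat) t :
  locally_const sigma t -> right_mode sigma t (sigma t).
Proof.
move=> [d [d0 hd]]; exists d; split=> // s ts std.
by apply: hd; apply: Rabs_def1; Lra.lra.
Qed.

Lemma locally_const_near (sigma : R -> nat) t : locally_const sigma t ->
  exists2 d, 0 < d & forall s, t - d < s < t + d ->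
    locally_const sigma s /\ sigma s = sigma t.
Proof.
move=> [d [d0 hd]]; exists d => // s hs.
have st : sigma s = sigma t by apply: hd; apply: Rabs_def1; Lra.lra.
split=> //; exists (d - Rabs (s - t)).
have h : Rabs (s - t) < d by apply: Rabs_def1; Lra.lra.
split; first by Lra.lra.
move=> u hu; rewrite st; apply: hd.
have := Rabs_triang (u - s) (s - t); rewrite (_ : u - s + (s - t) = u - t); Lra.lra.
Qed.

Lemma limit1_in_local (f g : R -> R) (D : R -> Prop) l t d : 0 < d ->
  (forall s, D s -> Rabs (s - t) < d -> f s = g s) ->
  limit1_in f D l t -> limit1_in g D l t.
Proof.
move=> d0 fg fl e e0; have [a [a0 ha]] := fl e e0.
exists (Rmin a d); split; first exact: Rmin_pos.
move=> s [Ds hs]; have := Rmin_l a d; have := Rmin_r a d => h1 h2.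
rewrite -fg //; last by move: hs; rewrite /= /Rdist; Lra.lra.
by apply: ha; split=> //; Lra.lra.
Qed.

Lemma limit1_in_le (f : R -> R) (D : R -> Prop) l t c :
  (forall d, 0 < d -> exists2 s, D s & Rabs (s - t) < d /\ c <= f s) ->
  limit1_in f D l t -> c <= l.
Proof.
move=> h fl; apply: Rnot_lt_le => lc.
have [|d [d0 hd]] := fl (c - l); first by Lra.lra.
have [s Ds [sd cs]] := h d d0.
have := hd s (conj Ds sd); rewrite /= /Rdist => /Rabs_def2; Lra.lra.
Qed.

Lemma limit1_in_const (c : R) D t : limit1_in (fun=> c) D c t.
Proof.
move=> e e0; exists 1; split; first exact: Rlt_0_1.
by move=> s _; rewrite /= /Rdist Rminus_diag Rabs_R0.
Qed.

Lemma continuity_pt_sides (f : R -> R) t :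
  limit1_in f (fun s => s < t) (f t) t -> limit1_in f (fun s => t < s) (f t) t ->
  continuity_pt f t.
Proof.
move=> fl fr e e0; have [a [a0 ha]] := fl e e0; have [b [b0 hb]] := fr e e0.
exists (Rmin a b); split; first exact: Rmin_pos.
move=> s [[_ ts] hs]; have := Rmin_l a b; have := Rmin_r a b => h1 h2.
case: (Rtotal_order s t) => [st|[st|st]].
- by apply: ha; split=> //; Lra.lra.
- by case: ts.
by apply: hb; split=> //; Lra.lra.
Qed.

End RealAnalysis.

(** * Derivatives and one-sided limits of vector functions *)

Lemma derivable_pt_lim_sum (I : Type) (l : seq I) (f : I -> R -> R) (d : I -> R) t :
  (forall i, derivable_pt_lim (f i) t (d i)) ->
  derivable_pt_lim (fun s => \sum_(i <- l) f i s) t (\sum_(i <- l) d i).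
Proof.
move=> fd; elim: l => [|a l IHl].
  rewrite big_nil (_ : (fun s => _) = fun=> 0); first exact: derivable_pt_lim_const.
  by apply: functional_extensionality => s; rewrite big_nil.
rewrite big_cons (_ : (fun s => _) = plus_fct (f a) (fun s => \sum_(i <- l) f i s)).
  exact: derivable_pt_lim_plus.
by apply: functional_extensionality => s; rewrite big_cons.
Qed.

Lemma limit1_in_sum (I : Type) (l : seq I) (f : I -> R -> R) (v : I -> R) D t :
  (forall i, limit1_in (f i) D (v i) t) ->
  limit1_in (fun s => \sum_(i <- l) f i s) D (\sum_(i <- l) v i) t.
Proof.
move=> fv; elim: l => [|a l IHl].
  rewrite big_nil (_ : (fun s => _) = fun=> 0); first exact: limit1_in_const.
  by apply: functional_extensionality => s; rewrite big_nil.
rewrite big_cons (_ : (fun s => _) = fun s => Rplus (f a s) (\sum_(i <- l) f i s)).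
  exact: limit_plus.
by apply: functional_extensionality => s; rewrite big_cons.
Qed.

Lemma has_deriv_mulmx m n (M : 'M[R]_(m, n)) x t dx :
  has_deriv x t dx -> has_deriv (fun s => M *m x s) t (M *m dx).
Proof.
move=> xd i; rewrite mxE.
rewrite (_ : (fun s => _) = fun s => \sum_j M i j * x s j 0).
  by apply: derivable_pt_lim_sum => j; apply: derivable_pt_lim_scal.
by apply: functional_extensionality => s; rewrite mxE.
Qed.

Lemma derivable_dot n (x y : R -> 'cV[R]_n) t dx dy :
  has_deriv x t dx -> has_deriv y t dy ->
  derivable_pt_lim (fun s => ((x s)^T *m y s) 0 0) t
    ((dx^T *m y t) 0 0 + ((x t)^T *m dy) 0 0).
Proof.
move=> xd yd; rewrite !mxE -big_split /=.
rewrite (_ : (fun s => _) = fun s => \sum_j x s j 0 * y s j 0).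
  apply: derivable_pt_lim_sum => j; rewrite !mxE.
  exact: (derivable_pt_lim_mult _ _ _ _ _ (xd j) (yd j)).
by apply: functional_extensionality => s; rewrite mxE; apply: eq_bigr => j _; rewrite mxE.
Qed.

Definition col_lim n (x : R -> 'cV[R]_n) (D : R -> Prop) (v : 'cV[R]_n) t :=
  forall i, limit1_in (fun s => x s i 0) D (v i 0) t.

Lemma col_lim_mulmx m n (M : 'M[R]_(m, n)) x D v t :
  col_lim x D v t -> col_lim (fun s => M *m x s) D (M *m v) t.
Proof.
move=> xd i; rewrite mxE.
rewrite (_ : (fun s => _) = fun s => \sum_j M i j * x s j 0).
  apply: limit1_in_sum => j.
  by apply: (limit_mul _ _ _ _ _ _ _ (xd j)); exact: limit1_in_const.
by apply: functional_extensionality => s; rewrite mxE.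
Qed.

Lemma limit_dot n (x y : R -> 'cV[R]_n) D v w t :
  col_lim x D v t -> col_lim y D w t ->
  limit1_in (fun s => ((x s)^T *m y s) 0 0) D ((v^T *m w) 0 0) t.
Proof.
move=> xd yd; rewrite mxE.
rewrite (_ : (fun s => _) = fun s => \sum_j x s j 0 * y s j 0).
  apply: limit1_in_sum => j; rewrite mxE.
  exact: (limit_mul _ _ _ _ _ _ (xd j) (yd j)).
by apply: functional_extensionality => s; rewrite mxE; apply: eq_bigr => j _; rewrite mxE.
Qed.

Lemma vnorm_sqnorm n (v : 'cV[R]_n) : vnorm v * vnorm v = sqnorm v.
Proof. by apply: sqrt_sqrt; apply/RleP; exact: sqnorm_ge0. Qed.

Lemma vnorm_ge0 n (v : 'cV[R]_n) : 0 <= vnorm v.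
Proof. by apply/RleP; exact: sqrt_pos. Qed.

Lemma entry_le_vnorm n (v : 'cV[R]_n) i : `|v i 0| <= vnorm v.
Proof.
rewrite -(ler_pXn2r (_ : 0 < 2)%N) ?nnegrE ?vnorm_ge0 // real_normK ?num_real //.
rewrite [leRHS]expr2 vnorm_sqnorm /sqnorm (bigD1 i) //= lerDl.
by apply: sumr_ge0 => j _; rewrite sqr_ge0.
Qed.

Lemma left_lim_col n (x : R -> 'cV[R]_n) t v :
  left_lim x t v -> col_lim x (fun s => Rlt s t) v t.
Proof.
move=> xl i e e0; have [d [d0 hd]] := xl e e0; exists d; split=> // s [st sd].
have /hd/(_ st)/RltP xe : Rlt (Rminus t d) s by move: sd => /= /Rabs_def2; Lra.lra.
apply/RltP; apply: le_lt_trans xe; have := entry_le_vnorm (x s - v) i.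
by rewrite !mxE.
Qed.

Lemma right_lim_col n (x : R -> 'cV[R]_n) t v :
  right_lim x t v -> col_lim x (fun s => Rlt t s) v t.
Proof.
move=> xl i e e0; have [d [d0 hd]] := xl e e0; exists d; split=> // s [st sd].
have /(hd _ st)/RltP xe : Rlt s (Rplus t d) by move: sd => /= /Rabs_def2; Lra.lra.
apply/RltP; apply: le_lt_trans xe; have := entry_le_vnorm (x s - v) i.
by rewrite !mxE.
Qed.

(** Describing the image of [T] as a kernel turns membership into a linear equation, which passes to
    derivatives. *)
Lemma image_test n (T : 'M[R]_n) : exists2 K : 'M[R]_n, K *m T = 0 &
  forall w : 'cV_n, K *m w = 0 -> exists v : 'cV_n, w = T *m v.
Proof.
exists (cokermx T^T)^T; first by apply: trmx_inj; rewrite trmx_mul trmxK mulmx_coker trmx0.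
move=> w Kw; have /submxP[v vE] : (w^T <= T^T)%MS.
  by rewrite submxE -[cokermx _]trmxK -trmx_mul Kw trmx0.
by exists v^T; rewrite -[w]trmxK vE trmx_mul trmxK.
Qed.

(** Near [t] the curve [z = Y^T x] satisfies [z = T z'], so it lies in the image of [T], and so does
    [z']. There [D] inverts [T], so [z' = D z] and [x = A^-1 X z'] is a function of [z]. *)
Lemma mode_derivative n r (E A : 'M[R]_n) (X Y : 'M[R]_(n, r)) (D : 'M[R]_r)
    (x : R -> 'cV[R]_n) t d :
  A \in unitmx -> E = X *m Y^T ->
  Etilde A X Y = D *m (Etilde A X Y *m Etilde A X Y) ->
  Rlt R0 d ->
  (forall s, Rlt (Rminus t d) s -> Rlt s (Rplus t d) ->
    exists2 dx, has_deriv x s dx & E *m dx = A *m x s) ->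
  exists dz, [/\ has_deriv (fun s => Y^T *m x s) t dz,
    Etilde A X Y *m dz = Y^T *m x t &
    x t = invmx A *m X *m D *m (Y^T *m x t)].
Proof.
move=> Au EE TD d0 hx; set T := Etilde A X Y in TD *.
have xE s dx : E *m dx = A *m x s -> x s = invmx A *m X *m (Y^T *m dx).
  by move=> e; rewrite -[LHS](mulKmx Au) -e EE !mulmxA.
have zE s dx : E *m dx = A *m x s -> Y^T *m x s = T *m (Y^T *m dx).
  by move=> /xE ->; rewrite /T /Etilde !mulmxA.
clearbody T; have [||dx xd e] := hx t; [Lra.lra | Lra.lra |].
have zd := has_deriv_mulmx Y^T xd.
exists (Y^T *m dx); rewrite -(zE _ _ e); split=> //.
have [K KT Kim] := image_test T.
have [|v vE] := Kim (Y^T *m dx).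
  apply/matrixP => i j; rewrite ord1 [RHS]mxE.
  apply: (uniqueness_limite (fun s => (K *m (Y^T *m x s)) i 0) t); first exact: has_deriv_mulmx.
  apply: (@derivable_pt_lim_locally_ext (fun=> 0) _ t (Rminus t d) (Rplus t d)); first Lra.lra.
    move=> s [h1 h2]; have [dx' _ e'] := hx s h1 h2.
    by rewrite (zE _ _ e') mulmxA KT mul0mx mxE.
  exact: derivable_pt_lim_const.
rewrite {1}(xE _ _ e) (zE _ _ e) vE -!mulmxA; congr (_ *m (_ *m _)).
by rewrite {1}TD !mulmxA.
Qed.

(** * Switched trajectories *)

Lemma limit1_in_unique (f : R -> R) (D : R -> Prop) l c t :
  (forall d, Rlt R0 d -> exists2 s, D s & Rlt (Rabs (Rminus s t)) d /\ f s = c) ->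
  limit1_in f D l t -> l = c.
Proof.
move=> h fl; case: (Req_EM_T l c) => // lc.
have [|d [d0 hd]] := fl (Rabs (Rminus c l)); first by apply: Rabs_pos_lt; Lra.lra.
have [s Ds [sd fs]] := h d d0.
by have := hd s (conj Ds sd); rewrite /= /Rdist fs => /Rlt_irrefl.
Qed.

Definition qform n (P : 'M[R]_n) (z : 'cV[R]_n) : R := (z^T *m (P *m z)) 0 0.

Lemma qform_le n (P : 'M[R]_n) :
  exists2 C, 0 < C & forall z, qform P z <= C * sqnorm z.
Proof.
have [C C0 hC] := sqnorm_mulmx P; exists (1 + C) => [|z]; first by rewrite addr_gt0.
have := dot_le z (P *m z); rewrite ler_norml -/(qform P z) => /andP[_].
have := hC z; have := sqnorm_ge0 z; have := mulr_ge0 (ltW C0) (sqnorm_ge0 z).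
rewrite mulrDl mul1r; lra.
Qed.

(** Substituting [z = T z'] puts the derivative in the form bounded by the Lyapunov inequality at
    the vector [z']. *)
Lemma qform_deriv n (P T : 'M[R]_n) (z : R -> 'cV[R]_n) t dz :
  P^T = P -> has_deriv z t dz -> T *m dz = z t ->
  derivable_pt_lim (fun s => qform P (z s)) t (2 * (dz^T *m P *m (T *m dz)) 0 0).
Proof.
move=> Ps zd zE; have := derivable_dot zd (has_deriv_mulmx P zd).
rewrite -zE (_ : ((T *m dz)^T *m (P *m dz)) 0 0 = (dz^T *m (P *m (T *m dz))) 0 0).
  by rewrite -mulmxA -mulr2n mulr_natl.
rewrite (_ : (T *m dz)^T *m (P *m dz) = (dz^T *m (P *m (T *m dz)))^T) ?mxE //.
by rewrite [in RHS]trmx_mul trmxK [in RHS]trmx_mul Ps mulmxA.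
Qed.

Lemma qform_limit n (P : 'M[R]_n) z D v t : col_lim z D v t ->
  limit1_in (fun s => qform P (z s)) D (qform P v) t.
Proof. by move=> zv; apply: limit_dot => //; apply: col_lim_mulmx. Qed.

Lemma exp_scal_derivable a t :
  derivable_pt_lim (fun s => exp (Rmult a s)) t (Rmult (exp (Rmult a t)) a).
Proof.
apply: (derivable_pt_lim_comp (fun s => Rmult a s) exp); last exact: derivable_pt_lim_exp.
rewrite -{2}[a]Rmult_1_r; apply: derivable_pt_lim_scal; exact: derivable_pt_lim_id.
Qed.

Section Switched.
Variables (n r : nat) (E A : nat -> 'M[R]_n) (X Y : nat -> 'M[R]_(n, r)).
Variables (D : nat -> 'M[R]_r) (P : 'M[R]_r) (k : R).
Local Notation T i := (Etilde (A i) (X i) (Y i)).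
Hypothesis Au : forall i, A i \in unitmx.
Hypothesis EE : forall i, E i = X i *m (Y i)^T.
Hypothesis TD : forall i, T i = D i *m (T i *m T i).
Hypothesis Ps : P^T = P.
Hypothesis lyap : forall i (z : 'cV_r),
  2 * (z^T *m P *m (T i *m z)) 0 0 <= - k * sqnorm (T i *m z).

Variables (t0 : R) (sigma : R -> nat) (x : R -> 'cV[R]_n).
Hypothesis sigma12 : forall t, sigma t = 1%N \/ sigma t = 2%N.
Hypothesis sigma_pc : piecewise_constant sigma.
Hypothesis x_t0 : right_lim x t0 (x t0).
Hypothesis x_flow : forall t, Rlt t0 t -> locally_const sigma t ->
  exists dx, has_deriv x t dx /\ E (sigma t) *m dx = A (sigma t) *m x t.
Hypothesis x_jump : forall t, Rlt t0 t -> ~ locally_const sigma t ->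
  exists xm i j, left_lim x t xm /\ right_lim x t (x t) /\
    left_mode sigma t i /\ right_mode sigma t j /\ (Y j)^T *m x t = (Y i)^T *m xm.

(** The mode active just after [t]. It matches the convention that [x t] is the right limit, whereas
    [sigma t] at a switching time need not be the incoming mode. *)
Let mode t : nat := if excluded_middle_informative (right_mode sigma t 1) then 1%N else 2%N.

Let mode_right t : right_mode sigma t (mode t).
Proof.
have [j jm] := right_mode_exists t sigma_pc; rewrite /mode.
case: excluded_middle_informative => // n1.
have [d d0 hd] := right_mode_locally_const jm.
have [|_ sj] := hd (Rplus t (Rdiv d (IZR 2))); first by Lra.lra.
have [s1|s2] := sigma12 (Rplus t (Rdiv d (IZR 2))); first by case: n1; rewrite -s1 sj.
by rewrite -s2 sj.
Qed.

Let modeE t j : right_mode sigma t j -> mode t = j.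
Proof. exact/right_mode_unique/mode_right. Qed.

Let z t : 'cV[R]_r := (Y (mode t))^T *m x t.
Let G i := invmx (A i) *m X i *m D i.

Let flow_near t : Rlt t0 t -> locally_const sigma t ->
  exists2 d, Rlt R0 d & forall s, Rlt (Rminus t d) s -> Rlt s (Rplus t d) ->
    mode s = mode t /\
    exists2 dx, has_deriv x s dx & E (mode t) *m dx = A (mode t) *m x s.
Proof.
move=> t0t lc; have [d d0 hd] := locally_const_near lc.
have mt := modeE (locally_const_right_mode lc).
exists (Rmin d (Rminus t t0)); first by apply: Rmin_pos; Lra.lra.
move=> s; have := Rmin_l d (Rminus t t0); have := Rmin_r d (Rminus t t0) => h1 h2 h3 h4.
have [|lcs st] := hd s; first by Lra.lra.
have [|dx [xd e]] := x_flow _ lcs; first by Lra.lra.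
rewrite (modeE (locally_const_right_mode lcs)) mt st; split=> //.
by exists dx; rewrite // -st.
Qed.

Let flow_qform t : Rlt t0 t -> locally_const sigma t ->
  x t = G (mode t) *m z t /\
  exists2 v, derivable_pt_lim (fun s => qform P (z s)) t v & v <= - k * sqnorm (z t).
Proof.
move=> t0t lc; have [d d0 hd] := flow_near t0t lc.
have [|dz [zd zE xE]] := mode_derivative (Au (mode t)) (EE (mode t)) (TD (mode t)) d0 (x := x) (t := t).
  by move=> s h1 h2; have [] := hd s h1 h2.
split=> //; exists (2 * (dz^T *m P *m (T (mode t) *m dz)) 0 0); last first.
  by rewrite /z -zE; exact: lyap.
apply: (@derivable_pt_lim_locally_ext _ _ t (Rminus t d) (Rplus t d)) (qform_deriv Ps zd zE).
  by Lra.lra.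
by move=> s [h1 h2]; have [ms _] := hd s h1 h2; rewrite /z ms.
Qed.

Let right_near t : Rle t0 t -> exists2 d, Rlt R0 d &
  forall s, Rlt t s -> Rlt s (Rplus t d) -> mode s = mode t /\ x s = G (mode t) *m ((Y (mode t))^T *m x s).
Proof.
move=> t0t; have [d d0 hd] := right_mode_locally_const (mode_right t).
exists d => // s ts std; have [//|lcs st] := hd s.
have ms : mode s = mode t by rewrite (modeE (locally_const_right_mode lcs)).
split=> //; have [|xs _] := flow_qform _ lcs; first by Lra.lra.
by rewrite {1}xs /z ms.
Qed.

Let right_lim_x t : Rle t0 t -> (t = t0 \/ ~ locally_const sigma t) -> right_lim x t (x t).
Proof.
move=> t0t [->//|nlc]; case: (Req_EM_T t0 t) => [<- //|nt].
by have [|xm [i [j [_ []]]]] := x_jump _ nlc; first by Lra.lra.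
Qed.

Let near_right t d : Rlt R0 d ->
  exists2 s, Rlt t s & Rlt s (Rplus t d) /\ Rlt (Rabs (Rminus s t)) d.
Proof.
move=> d0; exists (Rplus t (Rdiv d (IZR 2))); first by Lra.lra.
by split; [Lra.lra | apply: Rabs_def1; Lra.lra].
Qed.

Let consistent t : Rle t0 t -> x t = G (mode t) *m z t.
Proof.
move=> t0t.
have [c|xr] : (Rlt t0 t /\ locally_const sigma t) \/ right_lim x t (x t).
  case: (classic (locally_const sigma t)) => [lc|nlc].
    case: (Req_EM_T t0 t) => [<-|nt]; first by right.
    by left; split=> //; Lra.lra.
  by right; apply: right_lim_x => //; right.
  by have [] := flow_qform c.1 c.2.
have [d d0 hd] := right_near t0t; set i := mode t in hd *.
(* The relation holds just to the right of [t] as a linear equation [M x = 0], which passes to the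
   right limit [x t]. *)
pose M := 1%:M - G i *m (Y i)^T.
suff : M *m x t = 0 by rewrite mulmxBl mul1mx -mulmxA => /eqP; rewrite subr_eq0 => /eqP.
apply/matrixP => a b; rewrite ord1 [RHS]mxE.
apply: limit1_in_unique (col_lim_mulmx M (right_lim_col xr) a) => e e0.
have [s ts [se ste]] := @near_right t (Rmin d e) (Rmin_pos _ _ d0 e0).
have := Rmin_l d e; have := Rmin_r d e => h1 h2.
exists s => //; split; first by Lra.lra.
have [|_ xs] := hd s ts; first by Lra.lra.
by rewrite mulmxBl mul1mx -mulmxA -xs subrr mxE.
Qed.

Let qform_right t : Rle t0 t -> right_lim x t (x t) ->
  limit1_in (fun s => qform P (z s)) (fun s => Rlt t s) (qform P (z t)) t.
Proof.
move=> t0t xr; have [d d0 hd] := right_near t0t.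
apply: limit1_in_local (qform_limit P (col_lim_mulmx (Y (mode t))^T (right_lim_col xr))).
  exact: d0.
move=> s ts sd; have [|ms _] := hd s ts; first by move: sd => /Rabs_def2; Lra.lra.
by rewrite /z ms.
Qed.

(** At a switch the jump rule identifies the left limit of [z] with its value, the latter being
    taken in the incoming mode. *)
Let qform_continuous t : Rlt t0 t -> continuity_pt (fun s => qform P (z s)) t.
Proof.
move=> t0t; case: (classic (locally_const sigma t)) => [lc|nlc].
  have [_ [v hv _]] := flow_qform t0t lc.
  by apply: derivable_continuous_pt; exists v.
have [xm [i [j [xl [xr [[d [d0 hd]] [rm jump]]]]]]] := x_jump t0t nlc.
apply: continuity_pt_sides; last by apply: qform_right => //; Lra.lra.
have -> : z t = (Y i)^T *m xm by rewrite /z (modeE rm) jump.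
apply: limit1_in_local (qform_limit P (col_lim_mulmx (Y i)^T (left_lim_col xl))).
  exact: d0.
move=> s st sd; rewrite /z (_ : mode s = i) //; apply: modeE.
exists (Rminus t s); split; first by Lra.lra.
by move=> u su ut; apply: hd; move: sd => /Rabs_def2; Lra.lra.
Qed.

Variable al : R.
Hypothesis al_k : forall v : 'cV_r, 2 * al * qform P v <= k * sqnorm v.

(** The form weighted against its expected decay; [al_k] makes the derivative nonpositive along the
    flow. *)
Let W t := Rmult (exp (Rmult (2 * al) t)) (qform P (z t)).

Let W_nonincreasing s t : Rlt t0 s -> Rle s t -> Rle (W t) (W s).
Proof.
move=> t0s st; have [l hl] := sigma_pc s t.
apply: (@nonincreasing_finite_exceptions W l) => // u hu.
  apply: continuity_pt_mult; last by apply: qform_continuous; Lra.lra.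
  by apply: derivable_continuous_pt; exists (Rmult (exp (Rmult (2 * al) u)) (2 * al)); exact: exp_scal_derivable.
move=> ul; have lc : locally_const sigma u by apply: hl => //; Lra.lra.
have [|_ [v hv vle]] := flow_qform _ lc; first by Lra.lra.
exists (Rplus (Rmult (Rmult (exp (Rmult (2 * al) u)) (2 * al)) (qform P (z u)))
              (Rmult (exp (Rmult (2 * al) u)) v)).
  exact: derivable_pt_lim_mult (exp_scal_derivable _ _) hv.
have e0 := exp_pos (Rmult (2 * al) u); move: (exp _) e0 => e /RltP e0.
apply/RleP; rewrite -[Rplus _ _]/(e * (2 * al) * qform P (z u) + e * v).
by rewrite -mulrA -mulrDr pmulr_rle0 //; have := al_k (z u); lra.
Qed.

(** The flow equation is given only after [t0], so the bound from [t0] itself is obtained as a right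
    limit. *)
Let W_initial t : Rle t0 t -> Rle (W t) (W t0).
Proof.
move=> t0t; case: (Req_EM_T t0 t) => [->|nt]; first exact: Rle_refl.
apply: (@limit1_in_le W (fun s => Rlt t0 s) _ t0).
  move=> d d0; have m0 : Rlt R0 (Rmin d (Rminus t t0)) by apply: Rmin_pos; Lra.lra.
  have := Rmin_l d (Rminus t t0); have := Rmin_r d (Rminus t t0) => h1 h2.
  have [s ts [h3 h4]] := near_right t0 m0; exists s => //; split; first by Lra.lra.
  by apply: W_nonincreasing; Lra.lra.
apply: limit_mul; last by apply: qform_right => //; exact: Rle_refl.
have : continuity_pt (fun s => exp (Rmult (2 * al) s)) t0.
  by apply: derivable_continuous_pt; exists (Rmult (exp (Rmult (2 * al) t0)) (2 * al)); exact: exp_scal_derivable.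
move=> h e e0; have [d [d0 hd]] := h e e0; exists d; split=> // s [ts sd].
by apply: hd; split=> //; split=> //; Lra.lra.
Qed.

Lemma switched_decay t : Rle t0 t -> exists i j,
  [/\ x t = G i *m ((Y i)^T *m x t) &
      Rmult (exp (Rmult (2 * al) t)) (qform P ((Y i)^T *m x t)) <=
      Rmult (exp (Rmult (2 * al) t0)) (qform P ((Y j)^T *m x t0))].
Proof.
move=> t0t; exists (mode t), (mode t0); split; first exact: consistent.
by apply/RleP; exact: W_initial.
Qed.
End Switched.

(** * From a common Lyapunov function to exponential stability *)

Lemma sqnorm_mulmx2 m n (M1 M2 : 'M[R]_(m, n)) : exists2 C, 0 < C &
  forall i (v : 'cV_n), sqnorm (sel i M1 M2 *m v) <= C * sqnorm v.
Proof.
have [C1 C10 h1] := sqnorm_mulmx M1; have [C2 C20 h2] := sqnorm_mulmx M2.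
exists (C1 + C2) => [|i v]; first by rewrite addr_gt0.
have := mulr_ge0 (ltW C10) (sqnorm_ge0 v); have := mulr_ge0 (ltW C20) (sqnorm_ge0 v).
have := h1 v; have := h2 v; rewrite mulrDl /sel; case: ifP; lra.
Qed.

Lemma common_lyapunov_GUES n r (E1 E2 A1 A2 : 'M[R]_n) (X1 Y1 X2 Y2 : 'M[R]_(n, r))
    (D1 D2 P : 'M[R]_r) (k d : R) :
  A1 \in unitmx -> A2 \in unitmx -> E1 = X1 *m Y1^T -> E2 = X2 *m Y2^T ->
  Etilde A1 X1 Y1 = D1 *m (Etilde A1 X1 Y1 *m Etilde A1 X1 Y1) ->
  Etilde A2 X2 Y2 = D2 *m (Etilde A2 X2 Y2 *m Etilde A2 X2 Y2) ->
  P^T = P -> 0 < k -> 0 < d ->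
  (forall z, d * sqnorm z <= qform P z) ->
  (forall z : 'cV_r, 2 * (z^T *m P *m (Etilde A1 X1 Y1 *m z)) 0 0 <=
                     - k * sqnorm (Etilde A1 X1 Y1 *m z)) ->
  (forall z : 'cV_r, 2 * (z^T *m P *m (Etilde A2 X2 Y2 *m z)) 0 0 <=
                     - k * sqnorm (Etilde A2 X2 Y2 *m z)) ->
  GUES E1 A1 E2 A2 Y1 Y2.
Proof.
move=> Au1 Au2 EE1 EE2 TD1 TD2 Ps k0 d0 Pd ly1 ly2.
have [p p0 Pp] := qform_le P.
have [CG CG0 hG] := sqnorm_mulmx2 (invmx A1 *m X1 *m D1) (invmx A2 *m X2 *m D2).
have [CY CY0 hY] := sqnorm_mulmx2 Y1^T Y2^T.
(* Since [qform P z <= p |z|^2], the dissipation [k |z|^2] is at least [2 al] times the form. *)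
pose al := k / (2 * p); have al0 : 0 < al by rewrite divr_gt0 // mulr_gt0.
(* Collects the chain from [|x t|^2] to [|z|^2] and the form at [t], then back from the form at [t0]
   to [|x t0|^2]. *)
pose K := CG / d * p * CY.
have K0 : 0 < K by rewrite !mulr_gt0 // ?invr_gt0.
exists (sqrt K), al; split; first by apply: sqrt_lt_R0; apply/RltP.
split; first exact/RltP.
move=> t0 sigma x [s12 [pc [xt0 [flow jump]]]] t t0t.
have [|||||i [j [xE VE]]] := @switched_decay n r (fun i => sel i E1 E2) (fun i => sel i A1 A2)
  (fun i => sel i X1 X2) (fun i => sel i Y1 Y2) (fun i => sel i D1 D2) P k
  _ _ _ Ps _ t0 sigma x s12 pc xt0 flow jump al _ t t0t.
- by move=> i; rewrite /sel; case: ifP.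
- by move=> i; rewrite /sel; case: ifP.
- by move=> i; rewrite /sel; case: ifP.
- by move=> i z; rewrite /sel; case: ifP.
- move=> v; apply: (@le_trans _ _ (2 * al * (p * sqnorm v))).
    by rewrite ler_wpM2l // mulr_ge0 // ltW.
  rewrite mulrA (_ : 2 * al * p = k) // /al; field; exact: lt0r_neq0.
clearbody al.
have {}xE : x t = sel i (invmx A1 *m X1 *m D1) (invmx A2 *m X2 *m D2) *m
    (sel i Y1^T Y2^T *m x t) by move: xE; rewrite /sel; case: ifP.
have {}VE : exp (2 * al * t) * qform P (sel i Y1^T Y2^T *m x t) <=
    exp (2 * al * t0) * qform P (sel j Y1^T Y2^T *m x t0).
  by move: VE; rewrite /sel; case: ifP; case: ifP.
have qE : exp (Ropp (Rmult al (Rminus t t0))) ^+ 2 * exp (2 * al * t) = exp (2 * al * t0).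
  rewrite expr2 -[_ * _ * _]/(Rmult (Rmult _ _) _) -!exp_plus; congr (exp _).
  rewrite -[LHS]/(- (al * (t - t0)) + - (al * (t - t0)) + 2 * al * t) -[RHS]/(2 * al * t0).
  ring.
apply/RleP; move: qE (exp_pos (Ropp (Rmult al (Rminus t t0)))) => + /RltP.
move: (exp (Ropp _)) => q qE q0; rewrite -[X in _ <= X]/(sqrt K * q * vnorm (x t0)).
have e0 : 0 < exp (2 * al * t) by apply/RltP; exact: exp_pos.
have KK : sqrt K * sqrt K = K by apply: sqrt_sqrt; apply/RleP/ltW.
have sK : 0 <= sqrt K by apply/RleP; exact: sqrt_pos.
(* The bound is proved for squared norms, multiplied by [exp (2 al t)] so that [switched_decay]
   applies directly. *)
rewrite -(ler_pXn2r (_ : 0 < 2)%N) ?nnegrE ?mulr_ge0 ?vnorm_ge0 ?(ltW q0) //.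
rewrite 2!exprMn ![_ ^+ 2]expr2 !vnorm_sqnorm KK -expr2.
rewrite -(ler_pM2l e0).
have h1 := hG i (sel i Y1^T Y2^T *m x t); rewrite -xE in h1.
have h2 := Pd (sel i Y1^T Y2^T *m x t).
have h3 := Pp (sel j Y1^T Y2^T *m x t0).
have h4 := hY j (x t0).
have CGd : 0 < CG / d by rewrite divr_gt0.
apply: (@le_trans _ _ (CG / d * (exp (2 * al * t) * qform P (sel i Y1^T Y2^T *m x t)))).
  rewrite mulrCA ler_pM2l //; apply: le_trans h1 _.
  by rewrite -mulrA ler_pM2l // mulrC ler_pdivlMr // mulrC.
apply: (@le_trans _ _ (CG / d * (exp (2 * al * t0) * (p * (CY * sqnorm (x t0)))))).
  rewrite ler_pM2l //; apply: le_trans VE _.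
  have e00 : 0 < exp (2 * al * t0) by apply/RltP; exact: exp_pos.
  by rewrite ler_pM2l //; apply: le_trans h3 _; rewrite ler_pM2l.
rewrite -qE /K le_eqVlt; apply/orP; left; apply/eqP; ring.
Qed.

Theorem theorem5 (n r : nat) (E1 E2 A1 A2 : 'M[R]_n) (X1 Y1 X2 Y2 : 'M[R]_(n, r))
    (g h : 'cV[R]_r) :
  A1 \in unitmx -> A2 \in unitmx ->
  full_rank_decomp E1 X1 Y1 -> full_rank_decomp E2 X2 Y2 ->
  (* (a) *) desc_stable E1 A1 -> desc_stable E2 A2 ->
  (* (b) *) desc_index E1 A1 1 -> desc_index E2 A2 2 ->
  (* (c) *) Etilde A2 X2 Y2 = Etilde A1 X1 Y1 - g *m h^T ->
            controllable (Etilde A1 X1 Y1) g -> observable h^T (Etilde A1 X1 Y1) ->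
  (* (d) *) (forall l : R, Rlt l R0 ->
               ~~ eigenvalue (Etilde A1 X1 Y1 *m Etilde A2 X2 Y2) l) ->
            mup 0 (char_poly (Etilde A1 X1 Y1 *m Etilde A2 X2 Y2)) = 1%N ->
  GUES E1 A1 E2 A2 Y1 Y2.
Proof.
move=> Au1 Au2 fr1 fr2 st1 _ id1 id2 T2E ctr _ neg mu.
have T1u := index1_Etilde_unit Au1 fr1 id1.
have [D2 TD2] := index2_Etilde_drazin Au2 fr2 id2.
have [_ [_ EE1]] := fr1; have [_ [_ EE2]] := fr2.
have hur := stable_Etilde_hurwitz Au1 EE1 st1 T1u.
have [P [k [d [Ps k0 d0 Pd lyap]]]] : exists (P : 'M[R]_r) (k d : R), [/\ P^T = P, 0 < k, 0 < d,
    forall z : 'cV_r, d * sqnorm z <= (z^T *m P *m z) 0 0 &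
    forall B, B = Etilde A1 X1 Y1 \/ B = Etilde A2 X2 Y2 -> forall z : 'cV_r,
      2 * (z^T *m P *m (B *m z)) 0 0 <= - k * sqnorm (B *m z)].
  rewrite T2E; move: T2E T1u hur ctr neg mu => ->.
  move: (Etilde A1 X1 Y1) => T; clear.
  case: r T g h => [|m] T g h Tu hur ctr neg mu.
    (* For [r = 0] the characteristic polynomial is [1], which has no zero root, contradicting
       (d). *)
    by move: mu; rewrite (_ : char_poly _ = 1) ?mupNroot ?root1 // /char_poly det_mx00.
  apply: common_lyapunov => //; first exact: R_min_attained.
    rewrite -[RHS]ctr; congr (\rank _); apply/matrixP => i j; rewrite !mxE.
    suff -> : krylov T g j = mxpow T j *m g by rewrite mxE.
    elim: (nat_of_ord j) => [|q IHq]; first by rewrite mul1mx.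
    by rewrite /krylov /mxpow !iterS -mulmxA -/(mxpow T q) -IHq.
  by move=> l l0; rewrite -eigenvalue_root_char neg //; apply/RltP.
(* In mode 1 the matrix [T_1] is invertible, so its inverse serves as [D1]. *)
apply: (common_lyapunov_GUES (D1 := invmx (Etilde A1 X1 Y1)) (D2 := D2) Au1 Au2 EE1 EE2 _ TD2 Ps k0 d0).
- by rewrite mulmxA mulVmx // mul1mx.
- by move=> z; rewrite /qform mulmxA.
- by apply: lyap; left.
by apply: lyap; right.
Qed.
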